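(* Let $S$ be an inverse semigroup and $X$ a topological space. The category $\mathsf{Geom}(\mathsf{Sh}(X),\mathcal{B}(S))$ of geometric morphisms from $\mathsf{Sh}(X)$ to $\mathcal{B}(S)$ is equivalent to the category $\mathsf{Univ}(S,X)$ of universal $S$-bundles (universal $S$-sets) in the topos $\mathsf{Sh}(X)$.
   Context: $S$ is an inverse semigroup, $E(S)$ its semilattice of idempotents, $\mathbf{d}(s)=s^{-1}s$, $\mathbf{r}(s)=ss^{-1}$, $s\le t$ means $s=te$ for some $e\in E(S)$; for $Y\subseteq S$, $Y^{\uparrow}=\{s\in S: s\ge y\text{ for some }y\in Y\}$. Loganathan's category $L(S)$: objects are the elements of $E(S)$; arrows are pairs $(f,s)$ with $f\in E(S)$, $s\in S$, $\mathbf{r}(s)\le f$, regarded as an arrow from $\mathbf{d}(s)$ to $f$; composition is $(f,s)(\mathbf{d}(s),t)=(f,st)$. The classifying topos $\mathcal{B}(S)$ is the category of presheaves of sets $L(S)^{op}\to\mathsf{Sets}$. A geometric morphism $f\colon\mathcal{F}\to\mathcal{E}$ of toposes is a pair of functors $f^*\colon\mathcal{E}\to\mathcal{F}$ (inverse image), $f_*\colon\mathcal{F}\to\mathcal{E}$ with $f^*$ left adjoint to $f_*$ and $f^*$ preserving finite limits. $\mathsf{Geom}(\mathcal{F},\mathcal{E})$ has geometric morphisms as objects and natural transformations between the inverse image functors as morphisms. Sheaves: $\mathsf{Sh}(X)$ is identified with the category of étale spaces $p\colon E\to X$ ($p$ a local homeomorphism) and continuous maps over $X$; $E_x=p^{-1}(x)$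 is the stalk at $x$. $S$-sets: an $S$-set $(Y,\mu)$ is a set $Y$ with a semigroup homomorphism $\mu\colon S\to\mathcal{I}(Y)$ into the symmetric inverse semigroup of partial bijections of $Y$, with $s\cdot y=\mu(s)(y)$ where defined; $S$-sets are assumed effective: for every $y\in Y$ there is $s\in S$ with $s\cdot y$ defined. Two $S$-sets are equivalent if they are isomorphic (a bijection $f$ such that $s\cdot y$ is defined iff $s\cdot f(y)$ is, and then $f(s\cdot y)=s\cdot f(y)$). An inverse subsemigroup $H$ of $S$ is closed if $H^{\uparrow}=H$. Cosets with respect to $H$ are the sets $(xH)^{\uparrow}$ with $\mathbf{d}(x)\in H$; the set $X_H$ of cosets is an $S$-set where $s\cdot(xH)^{\uparrow}$ is defined iff $(sxH)^{\uparrow}$ is a coset, and then $s\cdot(xH)^{\uparrow}=(sxH)^{\uparrow}$. A filter in $E(S)$ is a nonempty upward closed subset closed under products. An $S$-set is universal if it is equivalent to $X_H$ with $H=F^{\uparrow}$ for some filter $F$ in $E(S)$. Universal $S$-sets (universal $S$-bundles) in $\mathsf{Sh}(X)$: an étale space $\pi\colon E\to X$ with an $S$-set structure $(E,\mu)$, $(s,e)\mapsto s\cdot e$ where defined, such that: (U1) for any $x\in X$ there is at least one $e\in E_x$ such that $s\cdot e$ is defined for some $s\in S$; (U2) for any $s\in S$ the set $\{e\in E: s\cdot e\text{ is defined}\}$ is open; (U3) if $s\cdot e$ is defined then $\pi(s\cdot e)=\pi(e)$; (U4) for any $x\in X$, the $S$-set $E_x$ with the restricted action is universal; (U5) the partially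 defined map $S\times E\to E$, $(s,e)\mapsto s\cdot e$, is continuous, $S$ being discrete. A morphism from $(E,\mu)$ to $(E',\nu)$ is a continuous map $f\colon E\to E'$ over $X$ such that whenever $s\cdot e$ is defined, the action of $s$ on $f(e)$ is defined and equals $f(s\cdot e)$. These form $\mathsf{Univ}(S,X)$. *)

(* Defs.v *)
From HB Require Import structures.
From mathcomp Require Import all_boot.
From mathcomp Require Import boolp classical_sets functions cardinality topology.

Set Implicit Arguments.
Unset Strict Implicit.
Unset Printing Implicit Defensive.

Local Open Scope classical_set_scope.

(* The objects of the category of sets live in the same universe as the carriers
   of topological spaces, so that presheaves and sheaves have the same notion of
   smallness. *)
Definition small : Type := Type@{Topological.axioms_.u0}.

Lemma sig_ext (T : Type) (P : T -> Prop) (a b : {x : T | P x}) :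
  sval a = sval b -> a = b.
Proof.
by case: a b => [a pa] [b pb] /= ab; subst b; rewrite (Prop_irrelevance pa pb).
Qed.

Record category : Type := Category {
  ob :> Type;
  hom : ob -> ob -> Type;
  idm : forall a, hom a a;
  comp : forall a b c, hom b c -> hom a b -> hom a c;
  comp1m : forall a b (f : hom a b), comp (idm b) f = f;
  compm1 : forall a b (f : hom a b), comp f (idm a) = f;
  compA : forall a b c d (h : hom c d) (g : hom b c) (f : hom a b),
    comp h (comp g f) = comp (comp h g) f
}.
Arguments hom {c} _ _ : rename.
Arguments idm {c} a : rename.
Arguments comp {c a b c0} _ _ : rename.

Notation "g \c f" := (comp g f) (at level 40, left associativity).

Definition op_cat (C : category) : category :=
  @Category (ob C) (fun a b => @hom C b a) (@idm C)
    (fun a b c g f => f \c g)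
    (fun a b f => compm1 f) (fun a b f => comp1m f)
    (fun a b c d h g f => esym (compA f g h)).

Record functor (C D : category) : Type := Functor {
  fob :> ob C -> ob D;
  fmap : forall a b, @hom C a b -> hom (fob a) (fob b);
  fmap1 : forall a, fmap (idm a) = idm (fob a);
  fmapM : forall a b c (g : @hom C b c) (f : @hom C a b),
    fmap (g \c f) = fmap g \c fmap f
}.
Arguments fmap {C D} _ {a b} _.

Definition id_functor (C : category) : functor C C :=
  @Functor C C id (fun _ _ f => f) (fun _ => erefl) (fun _ _ _ _ _ => erefl).

Section FunctorComposition.
Variables (C D E : category) (G : functor D E) (F : functor C D).

Let fcomp_map1 (a : C) : fmap G (fmap F (idm a)) = idm (G (F a)).
Proof. by rewrite !fmap1. Qed.

Let fcomp_mapM (a b c : C) (g : hom b c) (f : hom a b) :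
  fmap G (fmap F (g \c f)) = fmap G (fmap F g) \c fmap G (fmap F f).
Proof. by rewrite !fmapM. Qed.

Definition comp_functor : functor C E :=
  @Functor C E (fun a => G (F a)) (fun _ _ f => fmap G (fmap F f))
    fcomp_map1 fcomp_mapM.
End FunctorComposition.

Notation "G \of F" := (comp_functor G F) (at level 40, left associativity).

Record nattrans (C D : category) (F G : functor C D) : Type := NatTrans {
  component :> forall a : C, hom (F a) (G a);
  naturality : forall (a b : C) (f : hom a b),
    component b \c fmap F f = fmap G f \c component a
}.

Lemma nattrans_ext (C D : category) (F G : functor C D) (s t : nattrans F G) :
  (forall a, s a = t a) -> s = t.
Proof.
case: s t => [s sn] [t tn] /= st.
have {}st : s = t by apply: functional_extensionality_dep.
by subst t; rewrite (Prop_irrelevance sn tn).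
Qed.

Section NatTransCategory.
Variables C D : category.

Let nt_id_nat (F : functor C D) (a b : C) (f : hom a b) :
  idm (F b) \c fmap F f = fmap F f \c idm (F a).
Proof. by rewrite comp1m compm1. Qed.

Definition nt_id (F : functor C D) : nattrans F F := NatTrans (@nt_id_nat F).

Let nt_comp_nat (F G H : functor C D) (t : nattrans G H) (s : nattrans F G)
    (a b : C) (f : hom a b) :
  t b \c s b \c fmap F f = fmap H f \c (t a \c s a).
Proof. by rewrite -compA naturality compA naturality -compA. Qed.

Definition nt_comp (F G H : functor C D) (t : nattrans G H) (s : nattrans F G) :
  nattrans F H := NatTrans (nt_comp_nat t s).

Lemma nt_comp1m (F G : functor C D) (s : nattrans F G) :
  nt_comp (nt_id G) s = s.
Proof. by apply: nattrans_ext => a /=; rewrite comp1m. Qed.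

Lemma nt_compm1 (F G : functor C D) (s : nattrans F G) :
  nt_comp s (nt_id F) = s.
Proof. by apply: nattrans_ext => a /=; rewrite compm1. Qed.

Lemma nt_compA (F G H K : functor C D) (u : nattrans H K) (t : nattrans G H)
    (s : nattrans F G) :
  nt_comp u (nt_comp t s) = nt_comp (nt_comp u t) s.
Proof. by apply: nattrans_ext => a /=; rewrite compA. Qed.

Definition functor_cat : category :=
  @Category (functor C D) (@nattrans C D) nt_id nt_comp
    nt_comp1m nt_compm1 nt_compA.
End NatTransCategory.

Definition nat_isomorphic (C D : category) (F G : functor C D) : Prop :=
  exists (s : nattrans F G) (t : nattrans G F),
    forall a, t a \c s a = idm (F a) /\ s a \c t a = idm (G a).

Definition cat_equivalent (C D : category) : Prop :=
  exists (F : functor C D) (G : functor D C),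
    nat_isomorphic (G \of F) (id_functor C) /\
    nat_isomorphic (F \of G) (id_functor D).

(* [finite_set] is not usable here: its universe is bounded by that of
   [eqType] carriers, hence too small for the objects of a category. *)
Definition finitely_many (T : Type) : Prop :=
  exists (n : nat) (f : 'I_n -> T), forall t, exists i, f i = t.

Definition finite_category (J : category) : Prop :=
  finitely_many J /\ forall a b : J, finitely_many (hom a b).

Record cone (J C : category) (D : functor J C) : Type := Cone {
  apex : C;
  leg : forall j : J, hom apex (D j);
  leg_nat : forall (i j : J) (u : hom i j), fmap D u \c leg i = leg j
}.

Definition is_limit (J C : category) (D : functor J C) (c : cone D) : Prop :=
  forall c' : cone D, exists! m : hom (apex c') (apex c),
    forall j, leg c j \c m = leg c' j.

Section MapCone.
Variables (J C E : category) (F : functor C E) (D : functor J C) (c : cone D).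

Let map_leg_nat (i j : J) (u : hom i j) :
  fmap (F \of D) u \c fmap F (leg c i) = fmap F (leg c j).
Proof. by rewrite /= -fmapM leg_nat. Qed.

Definition map_cone : cone (F \of D) :=
  @Cone J E (F \of D) (F (apex c)) (fun j => fmap F (leg c j)) map_leg_nat.
End MapCone.

Definition preserves_finite_limits (C E : category) (F : functor C E) : Prop :=
  forall J : category, finite_category J ->
  forall (D : functor J C) (c : cone D), is_limit c -> is_limit (map_cone F c).

Record adjunction (C D : category) (L : functor C D) (R : functor D C) : Type :=
  Adjunction {
  adj_unit : nattrans (id_functor C) (R \of L);
  adj_counit : nattrans (L \of R) (id_functor D);
  triangle_left : forall a : C,
    adj_counit (L a) \c fmap L (adj_unit a) = idm (L a);
  triangle_right : forall b : D,
    fmap R (adj_counit b) \c adj_unit (R b) = idm (R b)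
}.

Record geometric_morphism (F E : category) : Type := GeometricMorphism {
  inverse_image : functor E F;
  direct_image : functor F E;
  inverse_direct_adj : adjunction inverse_image direct_image;
  inverse_image_lex : preserves_finite_limits inverse_image
}.

Definition Geom (F E : category) : category :=
  @Category (geometric_morphism F E)
    (fun f g => nattrans (inverse_image f) (inverse_image g))
    (fun f => nt_id (inverse_image f))
    (fun f g h t s => nt_comp t s)
    (fun f g s => nt_comp1m s) (fun f g s => nt_compm1 s)
    (fun f g h k u t s => nt_compA u t s).

Definition Sets : category :=
  @Category small (fun A B => A -> B) (fun A => id)
    (fun A B C g f => g \o f)
    (fun _ _ _ => erefl) (fun _ _ _ => erefl) (fun _ _ _ _ _ _ _ => erefl).

HB.mixin Record Semigroup_isInverse S of Semigroup S := {
  sinv : S -> S;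
  mulVK : forall s : S, (s * sinv s * s = s)%g;
  mulKV : forall s : S, (sinv s * s * sinv s = sinv s)%g;
  sinv_unique : forall s t : S, (s * t * s = s)%g -> (t * s * t = t)%g ->
    t = sinv s
}.

#[short(type="invSemigroupType")]
HB.structure Definition InvSemigroup :=
  {S of Semigroup_isInverse S & Semigroup S}.

Section InverseSemigroup.
Variable S : invSemigroupType.
Implicit Types s t u e f x y : S.
Local Open Scope group_scope.

Definition dom s : S := sinv s * s.
Definition ran s : S := s * sinv s.
Definition idem e : Prop := e * e = e.
Definition nle s t : Prop := exists2 e, idem e & s = t * e.
Definition upset (Y : set S) : set S := [set s | exists2 y, Y y & nle y s].

Lemma dom_idem s : idem (dom s).
Proof. by rewrite /idem /dom mulgA mulKV. Qed.

Lemma ran_idem s : idem (ran s).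
Proof. by rewrite /idem /ran mulgA mulVK. Qed.

Lemma mul_dom s : s * dom s = s.
Proof. by rewrite /dom mulgA mulVK. Qed.

Lemma ran_mul s : ran s * s = s.
Proof. exact: mulVK. Qed.

Lemma sinvK s : sinv (sinv s) = s.
Proof. by rewrite -(@sinv_unique _ (sinv s) s) ?mulKV ?mulVK. Qed.

Lemma sinv_idem e : idem e -> sinv e = e.
Proof. by move=> ee; rewrite -(@sinv_unique _ e e) // !ee. Qed.

Lemma idemM e f : idem e -> idem f -> idem (e * f).
Proof.
move=> ee ff; pose x := sinv (e * f).
have x1 : x * e * f * x = x by rewrite -(mulgA x) mulKV.
have x2 : e * f * x * e * f = e * f by rewrite -(mulgA _ e f) mulVK.
have h1 : e * f * (f * x * e) * (e * f) = e * f.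
  by rewrite !mulgA -(mulgA e f f) ff -(mulgA _ e e) ee.
have h3 : f * x * e * f * x * e = f * x * e by rewrite -[in RHS]x1 !mulgA.
have h2 : f * x * e * (e * f) * (f * x * e) = f * x * e.
  by rewrite !mulgA -(mulgA _ e e) ee -(mulgA _ f f) ff.
have xE : f * x * e = x by apply: sinv_unique.
have xx : idem x by rewrite /idem -xE !mulgA.
by rewrite -(sinvK (e * f)) -/x (sinv_idem xx).
Qed.

Lemma idemC e f : idem e -> idem f -> e * f = f * e.
Proof.
move=> ee ff; have ef := idemM ee ff; have fe := idemM ff ee.
rewrite -(sinv_idem fe); apply: sinv_unique.
  by rewrite !mulgA -(mulgA f e e) ee -(mulgA _ f f) ff -mulgA.
by rewrite !mulgA -(mulgA e f f) ff -(mulgA _ e e) ee -mulgA.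
Qed.

Lemma sinvM s t : sinv (s * t) = sinv t * sinv s.
Proof.
apply/esym/sinv_unique.
  have -> : s * t * (sinv t * sinv s) * (s * t) =
    s * (ran t * dom s) * t by rewrite /ran /dom !mulgA.
  rewrite (idemC (ran_idem t) (dom_idem s)) mulgA mul_dom -mulgA.
  by rewrite ran_mul.
have -> : sinv t * sinv s * (s * t) * (sinv t * sinv s) =
  sinv t * (dom s * ran t) * sinv s by rewrite /ran /dom !mulgA.
rewrite (idemC (dom_idem s) (ran_idem t)) /ran /dom !mulgA mulKV.
by rewrite -!mulgA (mulgA (sinv s)) mulKV.
Qed.

Lemma conj_idem e s : idem e -> idem (sinv s * e * s).
Proof.
move=> ee; rewrite /idem.
have -> : sinv s * e * s * (sinv s * e * s) = sinv s * (e * ran s) * e * s.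
  by rewrite /ran !mulgA.
rewrite (idemC ee (ran_idem s)) /ran !mulgA mulKV.
by rewrite -(mulgA _ e e) ee.
Qed.

Lemma idem_mul e s : idem e -> e * s = s * (sinv s * e * s).
Proof.
move=> ee; rewrite !mulgA -/(ran s) (idemC (ran_idem s) ee) -mulgA.
by rewrite ran_mul.
Qed.

Lemma nle_refl s : nle s s.
Proof. by exists (dom s); [exact: dom_idem | rewrite mul_dom]. Qed.

Lemma nle_trans s t u : nle s t -> nle t u -> nle s u.
Proof.
move=> [e ee ->] [f ff ->]; exists (f * e); last by rewrite mulgA.
exact: idemM.
Qed.

Lemma nleM s s' t t' : nle s s' -> nle t t' -> nle (s * t) (s' * t').
Proof.
move=> [e ee ->] [f ff ->].
exists ((sinv t' * e * t') * f).
  by apply: idemM => //; exact: conj_idem.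
by rewrite -(mulgA s') (mulgA e) (idem_mul _ ee) !mulgA.
Qed.

Lemma nle_sinv s t : nle s t -> nle (sinv s) (sinv t).
Proof.
move=> [e ee ->]; rewrite sinvM (sinv_idem ee) (idem_mul _ ee).
by eexists; last reflexivity; exact: conj_idem.
Qed.

Lemma nle_dom s t : nle s t -> nle (dom s) (dom t).
Proof. by move=> st; apply: nleM => //; exact: nle_sinv. Qed.

Lemma nle_idemr s e : idem e -> nle (s * e) s.
Proof. by exists e. Qed.

Lemma nle_ranM s t : nle (ran (s * t)) (ran s).
Proof.
rewrite /ran sinvM !mulgA -(mulgA s t) -/(ran t) (_ : s * ran t * sinv s =
  s * sinv s * (s * ran t * sinv s)); last by rewrite !mulgA mulVK.
apply: nle_idemr.
by have := conj_idem (sinv s) (ran_idem t); rewrite sinvK.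
Qed.

Lemma nle_domM s t : nle (dom (s * t)) (dom t).
Proof.
have := nle_ranM (sinv t) (sinv s).
by rewrite /ran /dom -sinvM !sinvK.
Qed.

Lemma domM s t : nle (ran t) (dom s) -> dom (s * t) = dom t.
Proof.
move=> [e ee rE]; have st : dom s * t = t.
  by rewrite -{1}(ran_mul t) rE -(mulgA (dom s)) (mulgA (dom s) (dom s))
    dom_idem mulgA -rE ran_mul.
by rewrite /dom sinvM -mulgA (mulgA (sinv s)) -/(dom s) st.
Qed.

Lemma dom_of_idem e : idem e -> dom e = e.
Proof. by move=> ee; rewrite /dom sinv_idem. Qed.

Lemma ran_of_idem e : idem e -> ran e = e.
Proof. by move=> ee; rewrite /ran sinv_idem. Qed.

(* The arrow [(f, s)] of Loganathan's category, from [dom s] to [f], is encoded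
   as the element [s] of the type of arrows from [dom s] to [f]. *)
Definition L_ob : Type := {e : S | idem e}.
Definition L_hom (e f : L_ob) : Type :=
  {s : S | dom s = sval e /\ nle (ran s) (sval f)}.

Let L_id_subproof (e : L_ob) :
  dom (sval e) = sval e /\ nle (ran (sval e)) (sval e).
Proof.
case: e => e ee /=; rewrite dom_of_idem// ran_of_idem//.
by split=> //; exact: nle_refl.
Qed.

Definition L_id (e : L_ob) : L_hom e e := exist _ (sval e) (L_id_subproof e).

Let L_comp_subproof (e f g : L_ob) (s : L_hom f g) (t : L_hom e f) :
  dom (sval s * sval t) = sval e /\ nle (ran (sval s * sval t)) (sval g).
Proof.
case: s t => s [ds rs] [t [dt rt]] /=; split.
  by rewrite domM ?ds.
exact: nle_trans (nle_ranM _ _) rs.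
Qed.

Definition L_comp (e f g : L_ob) (s : L_hom f g) (t : L_hom e f) : L_hom e g :=
  exist _ (sval s * sval t) (L_comp_subproof s t).

Let L_comp1m (e f : L_ob) (s : L_hom e f) : L_comp (L_id f) s = s.
Proof.
apply: sig_ext; case: s => s [_ [i ii rE]] /=; case: f rE => f ff /= rE.
by rewrite -{1}(ran_mul s) rE !mulgA ff -rE ran_mul.
Qed.

Let L_compm1 (e f : L_ob) (s : L_hom e f) : L_comp s (L_id e) = s.
Proof. by apply: sig_ext; case: s => s [ds rs] /=; rewrite -ds mul_dom. Qed.

Let L_compA (e f g h : L_ob) (u : L_hom g h) (t : L_hom f g) (s : L_hom e f) :
  L_comp u (L_comp t s) = L_comp (L_comp u t) s.
Proof. by apply: sig_ext; rewrite /= mulgA. Qed.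

Definition loganathan : category :=
  @Category L_ob L_hom L_id L_comp L_comp1m L_compm1 L_compA.

End InverseSemigroup.

Definition classifying_topos (S : invSemigroupType) : category :=
  functor_cat (op_cat (loganathan S)) Sets.

(* A partial bijection is given by its graph: [f y z] means that [f] is defined
   at [y] with value [z]. *)
Record pbij (Y : Type) : Type := PBij {
  graph :> Y -> Y -> Prop;
  graph_fun : forall y a b, graph y a -> graph y b -> a = b;
  graph_inj : forall a b y, graph a y -> graph b y -> a = b
}.

Definition pdom (Y : Type) (f : pbij Y) : set Y := [set y | exists z, f y z].

(* The value off the domain is irrelevant. *)
Definition papply (Y : Type) (f : pbij Y) (y : Y) : Y :=
  if pselect (pdom f y) is left h then sval (cid h) else y.

Section SymmetricInverseSemigroup.
Variable Y : Type.
Implicit Types f g h : pbij Y.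

Lemma pbij_ext f g : (forall y z, f y z <-> g y z) -> f = g.
Proof.
case: f g => [f ff fi] [g gf gi] /= fg.
have {}fg : f = g.
  by apply/funext => y; apply/funext => z; apply/propext.
by subst g; rewrite (Prop_irrelevance ff gf) (Prop_irrelevance fi gi).
Qed.

HB.instance Definition _ := gen_eqMixin (pbij Y).
HB.instance Definition _ := gen_choiceMixin (pbij Y).

Let pmul_fun f g y a b : (exists2 x, g y x & f x a) ->
  (exists2 x, g y x & f x b) -> a = b.
Proof.
move=> [x yx xa] [x' yx']; rewrite -(graph_fun yx yx') => xb.
exact: graph_fun xa xb.
Qed.

Let pmul_inj f g a b y : (exists2 x, g a x & f x y) ->
  (exists2 x, g b x & f x y) -> a = b.
Proof.
move=> [x ax xy] [x' bx' x'y].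
by move: bx'; rewrite -(graph_inj xy x'y); exact: graph_inj.
Qed.

Definition pmul f g : pbij Y := PBij (@pmul_fun f g) (@pmul_inj f g).

Definition pinv f : pbij Y :=
  @PBij Y (fun y z => f z y) (fun y a b => @graph_inj _ f a b y)
    (fun a b y => @graph_fun _ f y a b).

Let pmulA : associative pmul.
Proof.
move=> f g h; apply: pbij_ext => y z; split=> /=.
  by move=> [x [w yw wx] xz]; exists w => //; exists x.
by move=> [w yw [x wx xz]]; exists x => //; exists w.
Qed.

HB.instance Definition _ := isSemigroup.Build (pbij Y) pmulA.

Let pmulVK f : (f * pinv f * f = f)%g.
Proof.
apply: pbij_ext => y z; split=> /=.
  by move=> [a ya [b /= ba bz]]; rewrite (graph_inj ya ba).
by move=> yz; exists z => //; exists y.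
Qed.

Let pmulKV f : (pinv f * f * pinv f = pinv f)%g.
Proof.
apply: pbij_ext => y z; split=> /=.
  by move=> [a /= ay [b /= ab zb]]; rewrite (graph_fun ay ab).
by move=> zy; exists z => //; exists y.
Qed.

Let pinv_unique f g :
  (f * g * f = f)%g -> (g * f * g = g)%g -> g = pinv f.
Proof.
move=> fgf gfg; apply: pbij_ext => y z; split=> /=.
  move=> yz; have : (g * f * g)%g y z by rewrite gfg.
  move=> [a ya [b ab bz]].
  by move: ab; rewrite (graph_fun ya yz) (graph_inj bz yz).
move=> zy; have : (f * g * f)%g z y by rewrite fgf.
move=> [a za [b ab yb]].
by move: ab; rewrite (graph_fun za zy) (graph_inj yb zy).
Qed.

HB.instance Definition _ :=
  Semigroup_isInverse.Build (pbij Y) pmulVK pmulKV pinv_unique.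

End SymmetricInverseSemigroup.

Record sset (S : invSemigroupType) (Y : Type) : Type := SSet {
  smap :> {multiplicative S -> pbij Y};
  sset_effective : forall y, exists s, pdom (smap s) y
}.

Definition sset_equivalent (S : invSemigroupType) (Y Z : Type)
    (mu : sset S Y) (nu : sset S Z) : Prop :=
  exists f : Y -> Z, [/\ bijective f,
    forall s y, pdom (mu s) y <-> pdom (nu s) (f y) &
    forall s y y', mu s y y' -> nu s (f y) (f y')].

Section Restriction.
Variables (S : invSemigroupType) (Y : Type) (mu : sset S Y) (P : set Y).
Hypothesis P_stable : forall s y z, mu s y z -> P y -> P z.

Definition restr_map (s : S) : pbij {y | P y} :=
  @PBij {y | P y} (fun y z => mu s (sval y) (sval z))
    (fun y a b ya yb => sig_ext (graph_fun ya yb))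
    (fun a b y ay by' => sig_ext (graph_inj ay by')).

Let restr_mapM : {morph restr_map : s t / (s * t)%g}.
Proof.
move=> s t; apply: pbij_ext => -[y Py] [z Pz] /=.
rewrite gmulfM; split=> /= -[].
  by move=> x yx xz; exists (exist _ x (P_stable yx Py)).
by move=> [x Px] /= yx xz; exists x.
Qed.

HB.instance Definition _ := isMultiplicative.Build S (pbij {y | P y})
  restr_map restr_mapM.

Let restr_effective (y : {y | P y}) : exists s, pdom (restr_map s) y.
Proof.
case: y => y Py; have [s [z yz]] := sset_effective mu y.
by exists s, (exist _ z (P_stable yz Py)).
Qed.

Definition sset_restr : sset S {y | P y} :=
  @SSet S {y | P y} restr_map restr_effective.

End Restriction.

Record closed_inv_subsemigroup (S : invSemigroupType) : Type :=
  ClosedInvSubsemigroup {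
  cis_set : set S;
  cisM : forall s t, cis_set s -> cis_set t -> cis_set (s * t)%g;
  cisV : forall s, cis_set s -> cis_set (sinv s);
  cis_closed : upset cis_set = cis_set
}.

Section CosetAction.
Variables (S : invSemigroupType) (H : closed_inv_subsemigroup S).
Local Open Scope group_scope.

Definition lcoset (x : S) : set S := upset [set x * h | h in cis_set H].

Definition is_coset (C : set S) : Prop :=
  exists2 x, cis_set H (dom x) & C = lcoset x.

Definition coset : Type := {C : set S | is_coset C}.

Lemma cis_up s t : cis_set H s -> nle s t -> cis_set H t.
Proof. by move=> Hs st; rewrite -(cis_closed H); exists s. Qed.

Lemma lcoset_self (x : S) : cis_set H (dom x) -> lcoset x x.
Proof.
move=> Hx; exists x; last exact: nle_refl.
by exists (dom x) => //; exact: mul_dom.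
Qed.

Lemma lcosetM (s x y : S) : lcoset y x -> lcoset (s * x) `<=` lcoset (s * y).
Proof.
move=> [_ [h Hh <-] hx] z [_ [k Hk <-] kz].
exists (s * y * (h * k)); first by exists (h * k) => //; exact: cisM.
apply: nle_trans kz; rewrite !mulgA; apply: nleM; last exact: nle_refl.
by rewrite -!mulgA; apply: nleM => //; exact: nle_refl.
Qed.

Lemma lcoset_eqM (s x y : S) : cis_set H (dom x) -> cis_set H (dom y) ->
  lcoset x = lcoset y -> lcoset (s * x) = lcoset (s * y).
Proof.
move=> Hx Hy xy; apply/seteqP; split; apply: lcosetM.
  by rewrite -xy; exact: lcoset_self.
by rewrite xy; exact: lcoset_self.
Qed.

Lemma is_coset_dom (x : S) :
  is_coset (lcoset x) -> lcoset x x -> cis_set H (dom x).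
Proof.
move=> [y Hy ->] [_ [h Hh <-] hx].
apply: cis_up (nle_dom hx); rewrite /dom sinvM -!mulgA (mulgA (sinv y)).
by apply: cisM; [exact: cisV | apply: cisM].
Qed.

Lemma is_coset_domM (s x : S) :
  cis_set H (dom x) -> is_coset (lcoset (s * x)) -> cis_set H (dom (s * x)).
Proof.
move=> Hx /is_coset_dom; apply; exists (s * x); last exact: nle_refl.
by exists (dom x) => //; rewrite -mulgA mul_dom.
Qed.

Let coset_graph (s : S) (C C' : coset) : Prop :=
  exists x,
    [/\ cis_set H (dom x), sval C = lcoset x & sval C' = lcoset (s * x)].

Let coset_fun (s : S) (C A B : coset) :
  coset_graph s C A -> coset_graph s C B -> A = B.
Proof.
move=> [x [Hx Cx Ax]] [y [Hy Cy By]]; apply: sig_ext.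
by rewrite Ax By; apply: lcoset_eqM => //; rewrite -Cx.
Qed.

Lemma lcoset_cancel (s x : S) : cis_set H (dom x) -> cis_set H (dom (s * x)) ->
  lcoset (sinv s * (s * x)) = lcoset x.
Proof.
move=> Hx Hsx.
have xE : sinv s * (s * x) = x * dom (s * x).
  rewrite /dom sinvM (mulgA (sinv s)) -/(dom s) (idem_mul _ (dom_idem s)).
  by rewrite /dom !mulgA.
rewrite xE; apply/seteqP; split=> z [_ [h Hh <-] hz].
  exists (x * (dom (s * x) * h)); last by rewrite (mulgA x).
  by exists (dom (s * x) * h) => //; exact: cisM.
exists (x * dom (s * x) * h); first by exists h.
apply: nle_trans hz; apply: nleM; last exact: nle_refl.
by apply: nle_idemr; exact: dom_idem.
Qed.

Let coset_inj (s : S) (A B C : coset) :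
  coset_graph s A C -> coset_graph s B C -> A = B.
Proof.
move=> [x [Hx Ax Cx]] [y [Hy By Cy]]; apply: sig_ext.
have Hsx : cis_set H (dom (s * x)).
  by apply: is_coset_domM => //; rewrite -Cx; case: (C).
have Hsy : cis_set H (dom (s * y)).
  by apply: is_coset_domM => //; rewrite -Cy; case: (C).
rewrite Ax By -(lcoset_cancel Hx Hsx) -(lcoset_cancel Hy Hsy).
by apply: lcoset_eqM => //; rewrite -Cx.
Qed.

(* As [C'] ranges over cosets, [s] is defined at [lcoset x] precisely when
   [lcoset (s * x)] is a coset. *)
Definition coset_map (s : S) : pbij coset :=
  @PBij coset (coset_graph s) (@coset_fun s) (@coset_inj s).

Let coset_mapM : {morph coset_map : s t / s * t}.
Proof.
move=> s t; apply: pbij_ext => A C; split=> /=.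
  move=> [x [Hx Ax Cx]].
  have Hst : cis_set H (dom (s * (t * x))).
    by rewrite mulgA; apply: is_coset_domM => //; rewrite -Cx; case: (C).
  have Ht : cis_set H (dom (t * x)) := cis_up Hst (nle_domM _ _).
  have Ct : is_coset (lcoset (t * x)) by exists (t * x).
  exists (exist _ (lcoset (t * x)) Ct).
    by exists x.
  by exists (t * x); rewrite mulgA.
move=> [B [x [Hx Ax Bx]] [y [Hy By Cy]]].
exists x; split=> //; rewrite Cy -mulgA; apply: lcoset_eqM => //.
- by apply: is_coset_domM => //; rewrite -Bx; case: (B).
- by rewrite -By.
Qed.

HB.instance Definition _ := isMultiplicative.Build S (pbij coset)
  coset_map coset_mapM.

Let coset_effective (C : coset) : exists s, pdom (coset_map s) C.
Proof.
case: C => C Cx; have [x Hx CE] := Cx; exists (ran x), (exist _ C Cx), x.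
by split=> //=; rewrite ran_mul.
Qed.

Definition coset_sset : sset S coset := @SSet S coset coset_map coset_effective.

End CosetAction.

Record idem_filter (S : invSemigroupType) : Type := IdemFilter {
  idf_set : set S;
  idf_idem : forall e, idf_set e -> idem e;
  idf_neq0 : idf_set !=set0;
  idf_up : forall e f, idf_set e -> idem f -> nle e f -> idf_set f;
  idfM : forall e f, idf_set e -> idf_set f -> idf_set (e * f)%g
}.

Section FilterClosure.
Variables (S : invSemigroupType) (F : idem_filter S).

Let upfilterM s t :
  upset (idf_set F) s -> upset (idf_set F) t -> upset (idf_set F) (s * t)%g.
Proof.
by move=> [e Fe es] [f Ff ft]; exists (e * f)%g; [exact: idfM | exact: nleM].
Qed.

Let upfilterV s : upset (idf_set F) s -> upset (idf_set F) (sinv s).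
Proof.
move=> [e Fe es]; exists e => //.
by rewrite -(sinv_idem (idf_idem Fe)); exact: nle_sinv.
Qed.

Let upfilter_closed : upset (upset (idf_set F)) = upset (idf_set F).
Proof.
apply/seteqP; split=> s [t Ft ts].
  by have [e Fe et] := Ft; exists e => //; exact: nle_trans et ts.
by exists s; [exists t | exact: nle_refl].
Qed.

Definition upfilter : closed_inv_subsemigroup S :=
  @ClosedInvSubsemigroup S (upset (idf_set F))
    upfilterM upfilterV upfilter_closed.
End FilterClosure.

Definition universal_sset (S : invSemigroupType) (Y : Type) (mu : sset S Y) :
  Prop := exists F : idem_filter S, sset_equivalent mu (coset_sset (upfilter F)).

(* The inverse [g] of the restriction of [p] to [U] is extended arbitrarily
   off [p @` U]. *)
Definition local_homeomorphism (E X : topologicalType) (p : E -> X) : Prop :=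
  forall e : E, exists (U : set E) (g : X -> E),
    [/\ open U /\ U e, open (p @` U), {within U, continuous p},
        {within p @` U, continuous g} & forall y, U y -> g (p y) = y].

Record etale_space (X : topologicalType) : Type := EtaleSpace {
  total :> topologicalType;
  proj : total -> X;
  proj_local_homeo : local_homeomorphism proj
}.

Section Sheaves.
Variable X : topologicalType.
Implicit Types E : etale_space X.

Definition over E E' (f : E -> E') : Prop :=
  continuous f /\ forall e, proj (f e) = proj e.

Lemma over_id E : over (@id E).
Proof. by split=> // e; exact: cvg_id. Qed.

Lemma over_comp E E' E'' (g : E' -> E'') (f : E -> E') :
  over g -> over f -> over (g \o f).
Proof.
move=> [gc gp] [fc fp]; split=> [e|e /=]; last by rewrite gp fp.
by apply: continuous_comp; [exact: fc | exact: gc].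
Qed.

Definition Sh : category.
Proof.
refine (@Category (etale_space X) (fun E E' => {f : E -> E' | over f})
  (fun E => exist _ id (over_id E))
  (fun E E' E'' g f =>
     exist _ (sval g \o sval f) (over_comp (svalP g) (svalP f))) _ _ _).
- by move=> *; exact: sig_ext.
- by move=> *; exact: sig_ext.
- by move=> *; exact: sig_ext.
Defined.
End Sheaves.

Definition stalk (X : topologicalType) (E : etale_space X) (x : X) : set E :=
  [set e | proj e = x].

Section Stalk.
Variables (S : invSemigroupType) (X : topologicalType) (E : etale_space X).
Variables (mu : sset S E).
Hypothesis mu_fibre : forall s e e', mu s e e' -> proj e' = proj e.
Variable x : X.

Let stalk_stable s e e' : mu s e e' -> stalk x e -> stalk x e'.
Proof. by move=> /mu_fibre; rewrite /stalk /= => ->. Qed.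

Definition stalk_sset : sset S {e : E | stalk x e} := sset_restr stalk_stable.
End Stalk.

Record univ_bundle (S : invSemigroupType) (X : topologicalType) : Type :=
  UnivBundle {
  bundle :> etale_space X;
  act : sset S bundle;
  act_inhabited : forall x,
    exists2 e, stalk x e & exists s, pdom (act s) e;
  act_open : forall s, open (pdom (act s));
  act_fibre : forall s e e', act s e e' -> proj e' = proj e;
  act_universal : forall x, universal_sset (stalk_sset act_fibre x);
  act_continuous :
    {within [set se : discrete_topology S * bundle | pdom (act se.1) se.2],
      continuous (fun se : discrete_topology S * bundle =>
                    papply (act se.1) se.2)}
}.

Section UniversalBundles.
Variables (S : invSemigroupType) (X : topologicalType).
Implicit Types E : univ_bundle S X.

Definition equivariant E E' (f : E -> E') : Prop :=
  forall s e e', act E s e e' -> act E' s (f e) (f e').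

Definition univ_hom E E' : Type :=
  {f : E -> E' | over f /\ equivariant f}.

Let univ_id_subproof E : over (@id E) /\ equivariant (@id E).
Proof. by split=> //; exact: over_id. Qed.

Let univ_comp_subproof E E' E'' (g : univ_hom E' E'') (f : univ_hom E E') :
  over (sval g \o sval f) /\ equivariant (sval g \o sval f).
Proof.
case: g f => g [go ge] [f [fo fe]] /=; split; first exact: over_comp.
by move=> s e e' /fe/ge.
Qed.

Definition Univ : category.
Proof.
refine (@Category (univ_bundle S X) univ_hom
  (fun E => exist _ id (univ_id_subproof E))
  (fun E E' E'' g f => exist _ (sval g \o sval f) (univ_comp_subproof g f))
  _ _ _).
- by move=> *; exact: sig_ext.
- by move=> *; exact: sig_ext.
- by move=> *; exact: sig_ext.
Defined.
End UniversalBundles.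

(* Main.v *)
From HB Require Import structures.
From mathcomp Require Import all_boot.
From mathcomp Require Import boolp classical_sets topology.
Require Import Defs.

Set Implicit Arguments.
Unset Strict Implicit.
Unset Printing Implicit Defensive.

Local Open Scope classical_set_scope.

(** The proof rests on one presheaf [P] on Loganathan's category: [P d] is the
    set of the [s] with [dom s = d], restricted along arrows by right
    multiplication. Left multiplication is a partial action of [S] on [P]: the
    domain of [s] is the subpresheaf of the [p] with [ran p <= dom s], which is
    representable by [dom s]. So [P] with this action is a universal [S]-set in
    the topos of presheaves, and the equivalence sends a geometric morphism [f]
    to the sheaf [f^* P] with the image of the action, and a transformation to
    its component at [P].

    Three facts about points of inverse images are enough to see that [f^* P]
    is a universal bundle. Every point of [f^* Q] is the value [ev q a] of some
    [q : yo c -> Q] at a point [a] of [f^* (yo c)], because [f^*] has a right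
    adjoint ([ev_cover]); points of products of representables, and of
    equalizers of maps out of one, are covered in the same way, because [f^*]
    preserves these limits ([ev_span], [ev_eqz]). For this, limits of sheaves have to be read
    at points: for a finite diagram, a cone of sheaves is a limit if and only
    if it is one on each stalk ([limit_of_stalk_limit],
    [stalk_limit_of_limit]). On the other side, universal [S]-sets are
    recognised by an intrinsic criterion, [universal_ssetP]: they are nonempty,
    transitive, and an element that fixes a point is above an idempotent that
    is defined there. These three clauses correspond to the terminal object,
    products and equalizers.

    Representables embed in [P] and cover every presheaf, hence a
    transformation is determined by its component at [P]
    ([bundle_map_faithful]) and every equivariant map extends to a
    transformation ([bundle_map_full]).

    For essential surjectivity, let [E] be a universal bundle. The domains of
    the idempotents are open in [E] and form a functor [A] from Loganathan's
    category to sheaves, and the three clauses above make it flat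
    ([dom_functor_flat]). The tensor product with a flat functor is the inverse
    image of a geometric morphism ([tensor_morphism]): its right adjoint takes
    [F] to [c |-> Hom (A c, F)], and it preserves finite limits because, at a
    point, finitely many sections and finitely many equations between them can
    be moved to one common object ([tensor_stalk_limit]). Finally the tensor
    product of [P] and [A] is [E] again, by letting [p] in [P c] act on the
    points of [A c] ([bundle_of_surjective]). *)

(** * Étale spaces *)

Lemma finitely_many_near (I : Type) (T : topologicalType) (t : T)
    (P : I -> T -> Prop) :
  finitely_many I -> (forall i, \forall t' \near t, P i t') ->
  \forall t' \near t, forall i, P i t'.
Proof.
move=> [n [h hs]] nP.
have : \forall t' \near t, forall k, P (h k) t'.
  by apply: filter_forall => k; exact: nP.
by apply: filterS => t' Pt i; have [k <-] := hs i.
Qed.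

Lemma near_and (T : topologicalType) (t : T) (P Q : T -> Prop) :
  (\forall t' \near t, P t') -> (\forall t' \near t, Q t') ->
  \forall t' \near t, P t' /\ Q t'.
Proof. exact: filterI. Qed.

Lemma near_continuous (T T' : topologicalType) (f : T -> T') (t : T)
    (P : T' -> Prop) :
  {for t, continuous f} -> (\forall y \near f t, P y) ->
  \forall t' \near t, P (f t').
Proof. by move=> fc /fc. Qed.

Lemma open_nearP (T : topologicalType) (U : set T) :
  (forall t, U t -> \forall t' \near t, U t') -> open U.
Proof. by rewrite openE. Qed.

Lemma open_near (T : topologicalType) (U : set T) (t : T) :
  open U -> U t -> \forall t' \near t, U t'.
Proof. by move=> oU Ut; apply: open_nbhs_nbhs. Qed.

Lemma near_open (T : topologicalType) (t : T) (P : T -> Prop) :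
  (\forall t' \near t, P t') ->
  exists U : set T, [/\ open U, U t & forall t', U t' -> P t'].
Proof.
by rewrite /prop_near1/= nbhsE => -[U [oU Ut] UP]; exists U.
Qed.

Lemma continuous_near_eq (T T' : topologicalType) (f g : T -> T') (t : T) :
  (\forall t' \near t, f t' = g t') ->
  {for t, continuous g} -> {for t, continuous f}.
Proof.
move=> fg cg A; rewrite /= (nbhs_singleton fg) => /cg.
by rewrite /= !nbhs_simpl /=; apply: filterS2 fg => t' /= ->.
Qed.

Lemma local_homeomorphism_intro (E X : topologicalType) (p : E -> X) :
  continuous p -> (forall U, open U -> open (p @` U)) ->
  (forall e, exists2 U, open_nbhs e U &
     forall a b, U a -> U b -> p a = p b -> a = b) ->
  local_homeomorphism p.
Proof.
move=> pc po pinj e; have [U [oU Ue] Uinj] := pinj e.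
pose g x := if pselect ((p @` U) x) is left h then sval (cid2 h) else e.
have gK y : U y -> g (p y) = y.
  move=> Uy; rewrite /g; case: pselect => [h|]; last by case; exists y.
  by case: cid2 => z /= Uz pz; exact: Uinj.
exists U, g; split=> //; first exact: po.
  exact: continuous_subspaceT.
rewrite continuous_open_subspace; last exact: po.
move=> _ /set_mem [y Uy <-] A /=; rewrite nbhs_simpl /= gK //.
rewrite nbhsE => -[B [oB By] BA].
apply: (@filterS _ _ _ (p @` (B `&` U))).
  by move=> _ [z [Bz Uz] <-]; rewrite /= gK //; exact: BA.
by apply: open_near; [apply: po; exact: openI | exists y].
Qed.

Section Etale.
Variable X : topologicalType.
Implicit Types E F : etale_space X.

Lemma etale_chart E (e : E) : exists U (g : X -> E),
  [/\ open_nbhs e U, open (@proj X E @` U),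
      forall y, U y -> {for y, continuous (@proj X E)},
      forall x, (@proj X E @` U) x -> {for x, continuous g} &
      forall y, U y -> g (proj y) = y].
Proof.
have [U [g [[oU Ue] opU pc gc gK]]] := proj_local_homeo e.
exists U, g; split=> //.
  rewrite continuous_open_subspace// in pc.
  by move=> y Uy; apply: pc; exact/mem_set.
rewrite continuous_open_subspace// in gc.
by move=> x Ux; apply: gc; exact/mem_set.
Qed.

Lemma proj_continuous E : continuous (@proj X E).
Proof.
by move=> e; have [U [g [[oU Ue] _ pc _ _]]] := etale_chart e; exact: pc.
Qed.

Lemma local_section E (e : E) : exists2 g : X -> E, g (proj e) = e &
  \forall x \near proj e, proj (g x) = x /\ {for x, continuous g}.
Proof.
have [U [g [[oU Ue] opU pc gc gK]]] := etale_chart e.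
exists g; first exact: gK.
apply: filterS (open_near opU _); last by exists e.
by move=> _ [y Uy <-]; rewrite gK //; split=> //; apply: gc; exists y.
Qed.

Lemma proj_near_inj E (e : E) : exists2 U, open_nbhs e U &
  forall a b : E, U a -> U b -> proj a = proj b -> a = b.
Proof.
have [U [g [Ue _ _ _ gK]]] := etale_chart e; exists U => // a b Ua Ub ab.
by rewrite -(gK _ Ua) ab gK.
Qed.

(** Equalities at a point spread to a neighbourhood: [proj] is injective near
    [f t], and both lifts take values there. *)
Lemma lifts_agree_near (T : topologicalType) E (f g : T -> E) (t : T) :
  {for t, continuous f} -> {for t, continuous g} -> f t = g t ->
  (\forall t' \near t, proj (f t') = proj (g t')) ->
  \forall t' \near t, f t' = g t'.
Proof.
move=> fc gc fg pfg; have [U [oU Uf] Uinj] := proj_near_inj (f t).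
have Ug : U (g t) by rewrite -fg.
have nf : \forall t' \near t, U (f t') by apply: fc; exact: open_near.
have ng : \forall t' \near t, U (g t') by apply: gc; exact: open_near.
by apply: filterS3 nf ng pfg => t' Uft Ugt; exact: Uinj.
Qed.

Lemma over_continuous E F (f : E -> F) : over f -> continuous f.
Proof. by case. Qed.

(** If [g] is a section of [E] through [e], then [f \o g] and the identity are
    two lifts of [proj] that meet at [f e]; hence near [f e] every point is the
    image under [f] of a value of [g]. *)
Lemma over_open E F (f : E -> F) (U : set E) :
  over f -> open U -> open (f @` U).
Proof.
move=> [fc fp] oU; apply: open_nearP => _ [e Ue <-].
have [g ge gs] := local_section e.
have pc := @proj_continuous F (f e).
have gs' : \forall y \near f e, U (g (proj y)) /\
    {for y, continuous (f \o g \o @proj X F)} /\ proj (f (g (proj y))) = proj y.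
  have n1 : \forall x \near proj e, U (g x).
    have [_] := nbhs_singleton gs; apply; rewrite /= ge.
    exact: open_near.
  have n2 := near_and n1 gs; rewrite -(fp e) in n2.
  apply: filterS (near_continuous pc n2) => y /= [Uy [py gc]].
  split=> //; split; last by rewrite fp.
  apply: continuous_comp; first exact: proj_continuous.
  by apply: continuous_comp => //; exact: fc.
have : \forall y \near f e, (f \o g \o @proj X F) y = y.
  apply: lifts_agree_near.
  - by have [_ []] := nbhs_singleton gs'.
  - by [].
  - by rewrite /= fp ge.
  - by apply: filterS gs' => y [_ [_]].
by apply: filterS2 gs' => y [Uy _] /= <-; exists (g (proj y)).
Qed.

Lemma proj_open E (U : set E) : open U -> open (@proj X E @` U).
Proof.
move=> oU; apply: open_nearP => _ [e Ue <-].
have [g ge gs] := local_section e.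
have : \forall x \near proj e, U (g x).
  by have [_] := nbhs_singleton gs; apply; rewrite /= ge; exact: open_near.
by apply: filterS2 gs => x [px _] Ux; exists (g x).
Qed.

(** Maps over [X] being open, the bijective ones are homeomorphisms. *)
Lemma over_inverse E F (f : E -> F) (g : F -> E) :
  over f -> cancel f g -> cancel g f -> over g.
Proof.
move=> fo fK gK; split=> [|y]; last by rewrite -[in RHS](gK y) fo.2.
apply/continuousP => A /(over_open fo); congr open; apply/seteqP; split=> y.
  by move=> [e Ae <-]; rewrite /= fK.
by move=> Ay; exists (g y).
Qed.

End Etale.

Section OpenPart.
Variable T : topologicalType.

Definition open_part (U : set T) : Type := {t : T | U t}.

HB.instance Definition _ (U : set T) := gen_eqMixin (open_part U).
HB.instance Definition _ (U : set T) := gen_choiceMixin (open_part U).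
HB.instance Definition _ (U : set T) := Topological.copy (open_part U)
  (initial_topology (sval : open_part U -> T)).

Lemma sval_continuous (U : set T) : continuous (sval : open_part U -> T).
Proof. exact: initial_continuous. Qed.

Lemma open_part_continuous (T' : topologicalType) (U : set T)
    (f : T' -> open_part U) (t : T') :
  {for t, continuous (sval \o f)} -> {for t, continuous f}.
Proof.
move=> fc A; rewrite nbhsE => -[B [[C oC CB] Bf] BA].
have Cf : C (sval (f t)) by rewrite -CB in Bf.
apply: filterS (near_continuous fc (open_near oC Cf)) => t' Ct.
by apply: BA; rewrite -CB.
Qed.

Lemma sval_open (U : set T) (V : set (open_part U)) :
  open U -> open V -> open (sval @` V).
Proof.
move=> oU [W oW <-]; rewrite (_ : _ @` _ = U `&` W); first exact: openI.
apply/seteqP; split=> t; first by move=> [[x Ux] /= Wx <-].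
by move=> [Ut Wt]; exists (exist _ t Ut).
Qed.

End OpenPart.

Section EtaleOpenPart.
Variables (X : topologicalType) (E : etale_space X) (U : set E).
Hypothesis oU : open U.

Lemma open_part_local_homeo :
  local_homeomorphism (fun e : open_part U => proj (sval e)).
Proof.
apply: local_homeomorphism_intro.
- move=> e; apply: (@continuous_comp _ _ _ (sval : open_part U -> E)).
    exact: sval_continuous.
  exact: proj_continuous.
- move=> V oV; rewrite -image_comp; apply: proj_open; exact: sval_open.
- move=> e; have [V [oV Ve] Vinj] := proj_near_inj (sval e).
  exists (sval @^-1` V).
    split=> //; by exists V.
  by move=> a b Va Vb /(Vinj _ _ Va Vb)/sig_ext.
Qed.

Definition open_etale : etale_space X :=
  EtaleSpace open_part_local_homeo.

Lemma over_sval : over (sval : open_etale -> E).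
Proof. by split=> //; exact: sval_continuous. Qed.

Lemma over_corestrict (F : etale_space X) (f : F -> E)
    (fU : forall y, U (f y)) :
  over f -> over (fun y => exist _ (f y) (fU y) : open_etale).
Proof.
by move=> [fc fp]; split=> // y; apply: open_part_continuous; exact: fc.
Qed.

End EtaleOpenPart.

Lemma base_local_homeo (X : topologicalType) : local_homeomorphism (@id X).
Proof.
apply: local_homeomorphism_intro; first by move=> x; exact: cvg_id.
  by move=> U; rewrite image_id.
by move=> e; exists setT => //; split=> //; exact: openT.
Qed.

(** The terminal sheaf. Its open parts are the domains of local sections, which
    are thereby arrows of [Sh X]. *)
Definition base (X : topologicalType) : etale_space X :=
  EtaleSpace (@base_local_homeo X).

(** * Finite limits of sheaves are computed stalkwise *)

Section StalkLimits.
Variable X : topologicalType.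

Definition app (E F : Sh X) (f : hom E F) : (E : etale_space X) ->
  (F : etale_space X) := sval f.

Lemma app_over (E F : Sh X) (f : hom E F) : over (app f).
Proof. exact: (svalP f). Qed.

Lemma app_continuous (E F : Sh X) (f : hom E F) : continuous (app f).
Proof. by have [] := app_over f. Qed.

Lemma proj_app (E F : Sh X) (f : hom E F) e : proj (app f e) = proj e.
Proof. by have [_ ->] := app_over f. Qed.

Lemma app_comp (E F G : Sh X) (g : hom F G) (f : hom E F) e :
  app (g \c f) e = app g (app f e).
Proof. by []. Qed.

Lemma app_idm (E : Sh X) e : app (idm E) e = e.
Proof. by []. Qed.

Lemma app_ext (E F : Sh X) (f g : hom E F) : app f =1 app g -> f = g.
Proof. by move=> fg; apply: sig_ext; apply/funext. Qed.

Variables (J : category) (D : functor J (Sh X)).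

(** On each stalk the cone is a limit of sets. *)
Definition stalk_limit (c : cone D) : Prop :=
  forall (x : X) (z : forall j, (D j : etale_space X)),
    (forall j, proj (z j) = x) ->
    (forall i j (u : hom i j), app (fmap D u) (z i) = z j) ->
    exists! w : (apex c : etale_space X),
      proj w = x /\ forall j, app (leg c j) w = z j.

(** Pointwise there is only one candidate [m] for the mediating map. It is
    continuous: take a section [g] of the apex through [m e]; its legs agree
    with those of the given cone at [e], hence near [e], for all of the finitely
    many [j] at once, so that uniqueness gives [m = g] near [e]. *)
Lemma limit_of_stalk_limit (c : cone D) :
  finite_category J -> stalk_limit c -> is_limit c.
Proof.
move=> [Jfin _] cl c'; pose A' : etale_space X := apex c'.
have ex (e : A') : exists! w : (apex c : etale_space X), proj w = proj e /\
    forall j, app (leg c j) w = app (leg c' j) e.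
  apply: cl => [j|i j u]; first by rewrite proj_app.
  by rewrite -app_comp leg_nat.
pose m (e : A') : (apex c : etale_space X) := sval (cid (ex e)).
have [mp mleg] : (forall e, proj (m e) = proj e) /\
    forall e j, app (leg c j) (m e) = app (leg c' j) e.
  by split=> e; rewrite /m; case: cid => w [[]].
have muniq e w : proj w = proj e ->
    (forall j, app (leg c j) w = app (leg c' j) e) -> m e = w.
  by move=> wp wl; rewrite /m; case: cid => w' [_ /=]; apply.
have mo : over m.
  split=> // e.
  have [g gm] := local_section (m e); rewrite mp in gm * => gs.
  have pe := @proj_continuous X A' e.
  have gsA := near_continuous pe gs.
  have near_leg : \forall e' \near e, forall j,
      app (leg c j) (g (proj e')) = app (leg c' j) e'.
    apply: finitely_many_near => // j; apply: lifts_agree_near.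
    - apply: (@continuous_comp _ _ _ (g \o @proj X A') (app (leg c j))).
        apply: continuous_comp => //.
        by have [] := nbhs_singleton gs.
      exact: app_continuous.
    - exact: app_continuous.
    - by rewrite gm mleg.
    - apply: filterS gsA => e' [pg _].
      by rewrite proj_app proj_app.
  apply: (@continuous_near_eq _ _ m (g \o @proj X A')).
    apply: filterS (near_and gsA near_leg) => e' [[pg _] lg].
    exact: muniq.
  by apply: continuous_comp => //; have [] := nbhs_singleton gs.
exists (exist _ m mo); split=> [j|[m' m'o] m'leg].
  by apply: app_ext => e; exact: mleg.
apply: app_ext => e; apply: muniq; first exact: (proj_app (exist _ m' m'o)).
by move=> j; rewrite -(m'leg j).
Qed.

(** Sections through the given points are compatible at [x], hence, [J] being
    finite, on an open neighbourhood [V]: they form a cone with apex [V], and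
    its mediating map has the required value at [x]. Uniqueness follows by
    comparing sections of the apex through two candidates on a smaller open
    set. *)
Lemma stalk_limit_of_limit (c : cone D) :
  finite_category J -> is_limit c -> stalk_limit c.
Proof.
move=> [Jfin homfin] cl x z zx zcomp.
(* Two sections over [V] with the same legs mediate for the same cone. *)
have agree (V : set X) (oV : open V)
    (h h' : open_part (V : set (base X)) -> (apex c : etale_space X)) :
    over (h : open_etale (E := base X) oV -> _) ->
    over (h' : open_etale (E := base X) oV -> _) ->
    (forall j b, app (leg c j) (h b) = app (leg c j) (h' b)) -> h = h'.
  move=> ho h'o hh'.
  pose hm : @hom (Sh X) (open_etale (E := base X) oV) (apex c) := exist _ h ho.
  pose hm' : @hom (Sh X) (open_etale (E := base X) oV) (apex c) :=
    exist _ h' h'o.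
  have ln i j (u : hom i j) : fmap D u \c (leg c i \c hm) = leg c j \c hm.
    by rewrite compA leg_nat.
  have [m [_ mu]] := cl (Cone ln).
  have e1 : m = hm by apply: mu.
  have e2 : m = hm'.
    by apply: mu => j; apply: app_ext => b; exact: esym (hh' j b).
  by have := congr1 sval (etrans (esym e1) e2).
have secP j : {g : X -> (D j : etale_space X) | g x = z j &
    \forall y \near x, proj (g y) = y /\ {for y, continuous g}}.
  by apply/cid2; have [g] := local_section (z j); rewrite zx; exists g.
pose g j := s2val (secP j).
have gx j : g j x = z j := s2valP (secP j).
have gs j : \forall y \near x, proj (g j y) = y /\ {for y, continuous (g j)}.
  exact: s2valP' (secP j).
have gcomp i j (u : hom i j) :
    \forall y \near x, app (fmap D u) (g i y) = g j y.
  apply: lifts_agree_near.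
  - apply: (@continuous_comp _ _ _ (g i) (app (fmap D u))).
      by have [] := nbhs_singleton (gs i).
    exact: app_continuous.
  - by have [] := nbhs_singleton (gs j).
  - by rewrite !gx.
  - apply: filterS (near_and (gs i) (gs j)) => y [[pi _] [pj _]].
    by rewrite proj_app pi pj.
have : \forall y \near x, forall j,
    proj (g j y) = y /\ {for y, continuous (g j)}.
  exact: finitely_many_near.
have : \forall y \near x, forall i j (u : hom i j),
    app (fmap D u) (g i y) = g j y.
  do 2 (apply: finitely_many_near => // ?).
  exact: finitely_many_near.
move=> n1 n2; have [V [oV Vx VP]] := near_open (near_and n1 n2).
pose B := open_etale (E := base X) oV.
have lo j : over ((fun b => g j (sval b)) : B -> (D j : etale_space X)).
  split=> b; last by have [_ /(_ j) []] := VP _ (svalP b).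
  apply: (@continuous_comp _ _ _ (sval : B -> X) (g j)).
    exact: sval_continuous.
  by have [_ /(_ j) []] := VP _ (svalP b).
pose lg j : @hom (Sh X) B (D j) := exist _ _ (lo j).
have ln i j (u : hom i j) : fmap D u \c lg i = lg j.
  by apply: app_ext => b; have [+ _] := VP _ (svalP b); apply.
have [m [ml _]] := cl (Cone ln).
pose b0 : B := exist _ x Vx.
exists (app m b0); split.
  split=> [|j]; first by rewrite proj_app.
  by rewrite -app_comp ml /= gx.
move=> w [wx wl].
have [h hx hs] := local_section w; rewrite wx in hx hs.
have [k kx ks] := local_section (app m b0).
have mx : proj (app m b0) = x by rewrite proj_app.
rewrite mx in kx ks.
have nhk : \forall y \near x, forall j,
    app (leg c j) (h y) = app (leg c j) (k y).
  apply: finitely_many_near => // j; apply: lifts_agree_near.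
  - apply: (@continuous_comp _ _ _ h (app (leg c j))).
      by have [] := nbhs_singleton hs.
    exact: app_continuous.
  - apply: (@continuous_comp _ _ _ k (app (leg c j))).
      by have [] := nbhs_singleton ks.
    exact: app_continuous.
  - by rewrite hx kx wl -app_comp ml /= gx.
  - apply: filterS (near_and hs ks) => y [[ph _] [pk _]].
    by rewrite !proj_app ph pk.
have [W [oW Wx WP]] := near_open (near_and nhk (near_and hs ks)).
have so (f : X -> (apex c : etale_space X)) :
    (forall y, W y -> proj (f y) = y /\ {for y, continuous f}) ->
    over ((fun b => f (sval b)) :
      open_etale (E := base X) oW -> (apex c : etale_space X)).
  move=> fs; split=> b; last by have [] := fs _ (svalP b).
  apply: (@continuous_comp _ _ _ (sval : open_etale (E := base X) oW -> X) f).
    exact: sval_continuous.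
  by have [] := fs _ (svalP b).
have hk : (fun b : open_etale (E := base X) oW => k (sval b)) =
    (fun b => h (sval b)).
  apply: agree.
  - by apply: so => y /WP [_ []].
  - by apply: so => y /WP [_ []].
  - by move=> j b; have [-> _] := WP _ (svalP b).
rewrite -hx -kx.
exact: (congr1 (fun q => q (exist _ x Wx : open_etale (E := base X) oW)) hk).
Qed.

End StalkLimits.

(** * Presheaves on Loganathan's category *)

Section Presheaves.
Variable S : invSemigroupType.
Local Notation L := (loganathan S).
Local Notation PSh := (classifying_topos S).
Local Notation presheaf := (functor (op_cat L) Sets).

Definition res (Q : presheaf) (c d : L) (u : hom d c) (q : Q c) : Q d :=
  @fmap (op_cat L) Sets Q c d u q.

Lemma res_idm (Q : presheaf) (c : L) (q : Q c) : res (idm c) q = q.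
Proof. by rewrite /res (@fmap1 (op_cat L) Sets Q). Qed.

Lemma res_comp (Q : presheaf) (c d e : L) (u : hom d c) (v : hom e d)
    (q : Q c) : res (u \c v) q = res v (res u q).
Proof. by rewrite /res (@fmapM (op_cat L) Sets Q c d e v u). Qed.

Lemma res_nat (Q Q' : presheaf) (t : nattrans Q Q') (c d : L) (u : hom d c)
    (q : Q c) : t d (res u q) = res u (t c q).
Proof. exact: (congr1 (fun h => h q) (@naturality _ _ _ _ t c d u)). Qed.

Lemma psh_ext (Q Q' : PSh) (t t' : hom Q Q') :
  (forall (c : L) (q : (Q : presheaf) c),
     (t : nattrans _ _) c q = (t' : nattrans _ _) c q) ->
  t = t'.
Proof.
by move=> tt'; apply: nattrans_ext => c; apply/funext => q; exact: tt'.
Qed.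

Section Yoneda.
Variable c : L.

(* [L_hom] is a small set, whereas [hom] lives in the universe of the arrows of
   all categories. *)
Let yo_ob (d : op_cat L) : Sets := L_hom d c.
Let yo_map (d e : op_cat L) (u : hom d e) : hom (yo_ob d) (yo_ob e) :=
  fun s => @comp L e d c s u.
Let yo_map1 (d : op_cat L) : yo_map (idm d) = idm (yo_ob d).
Proof. by apply/funext => s; exact: (@compm1 L). Qed.
Let yo_mapM (d e g : op_cat L) (v : hom e g) (u : hom d e) :
  yo_map (v \c u) = yo_map v \c yo_map u.
Proof. by apply/funext => s; exact: (@compA L). Qed.

Definition yo : presheaf := Functor yo_map1 yo_mapM.

Variables (Q : presheaf) (q : Q c).

Let yomap_nat (d e : op_cat L) (u : hom d e) :
  (fun s : yo e => res s q : Q e) \o fmap yo u =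
  fmap Q u \o (fun s : yo d => res s q : Q d).
Proof. by apply/funext => s; exact: res_comp. Qed.

Definition yomap : nattrans yo Q :=
  @NatTrans (op_cat L) Sets yo Q (fun d (s : yo d) => res s q) yomap_nat.

End Yoneda.

Lemma yomap_comp (c : L) (Q Q' : presheaf) (q : Q c) (t : nattrans Q Q') :
  nt_comp t (yomap q) = yomap (t c q).
Proof. by apply: psh_ext => d s /=; rewrite res_nat. Qed.

Section Evaluation.
Variables (X : topologicalType) (G : functor PSh (Sh X)).

Definition pts (Q : PSh) : etale_space X := G Q.

(** By Yoneda [q] is a map [yo c -> Q]; its image under [G] acts on points. *)
Definition ev (c : L) (Q : presheaf) (q : Q c) (a : pts (yo c)) : pts Q :=
  app (@fmap _ _ G (yo c) Q (yomap q)) a.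

Lemma ev_nat (c : L) (Q Q' : presheaf) (t : nattrans Q Q') (q : Q c)
    (a : pts (yo c)) :
  app (@fmap _ _ G Q Q' t) (ev q a) = ev (t c q) a.
Proof. by rewrite /ev -app_comp -fmapM -yomap_comp. Qed.

Lemma ev_res (c d : L) (Q : presheaf) (q : Q c) (u : yo c d) (a : pts (yo d)) :
  ev q (ev u a) = ev (res u q) a.
Proof. exact: (ev_nat (yomap q) (u : yo c d)). Qed.

Lemma proj_ev (c : L) (Q : presheaf) (q : Q c) (a : pts (yo c)) :
  proj (ev q a) = proj a.
Proof. exact: proj_app. Qed.

Lemma ev_over (c : L) (Q : presheaf) (q : Q c) : over (ev q).
Proof. exact: app_over. Qed.

End Evaluation.
End Presheaves.

(** * Two shapes of finite diagrams *)

Lemma finitely_many_finType (I : finType) : finitely_many I.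
Proof.
exists #|I|, enum_val => i; exists (enum_rank i); exact: enum_rankK.
Qed.

Lemma finitely_many_Prop (P : Prop) : finitely_many P.
Proof.
have [p|np] := pselect P.
  by exists 1, (fun _ => p) => q; exists ord0; exact: Prop_irrelevance.
have h0 (i : 'I_0) : P by case: i.
by exists 0, h0 => p; case: np.
Qed.

Definition discrete_cat (I : Type) : category :=
  @Category I (fun i j => i = j) (fun i => erefl)
    (fun i j k jk ij => etrans ij jk)
    (fun _ _ _ => Prop_irrelevance _ _) (fun _ _ _ => Prop_irrelevance _ _)
    (fun _ _ _ _ _ _ _ => Prop_irrelevance _ _).

Lemma discrete_cat_finite (I : finType) : finite_category (discrete_cat I).
Proof.
split=> [|i j]; first exact: finitely_many_finType.
exact: (finitely_many_Prop (i = j)).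
Qed.

Section DiscreteFunctor.
Variables (I : Type) (C : category) (D : I -> C).

Definition discrete_map (i j : I) (ij : i = j) : hom (D i) (D j) :=
  match ij with erefl => idm (D i) end.

Let discrete_mapM (i j k : I) (jk : j = k) (ij : i = j) :
  discrete_map (etrans ij jk) = discrete_map jk \c discrete_map ij.
Proof. by case: k / jk; rewrite comp1m. Qed.

Definition discrete_functor : functor (discrete_cat I) C :=
  @Functor (discrete_cat I) C D discrete_map (fun _ => erefl) discrete_mapM.
End DiscreteFunctor.

Definition pair_hom (i j : bool) : Type :=
  match i, j with
  | false, true => bool
  | true, false => void
  | _, _ => unit
  end.

Definition pair_idm (i : bool) : pair_hom i i :=
  match i with true => tt | false => tt end.

Definition pair_comp (i j k : bool) :
    pair_hom j k -> pair_hom i j -> pair_hom i k :=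
  match i, j, k with
  | false, false, true => fun v _ => v
  | false, true, true => fun _ u => u
  | false, _, false => fun _ _ => tt
  | true, false, _ => fun _ u => match u with end
  | true, true, _ => fun v _ => v
  end.

(** The shape of equalizers. *)
Definition parallel_cat : category.
Proof.
refine (@Category bool pair_hom pair_idm pair_comp _ _ _).
- by case; case; case.
- by case; case; case.
- by case; case; case; case=> //= -[].
Defined.

Lemma parallel_cat_finite : finite_category parallel_cat.
Proof.
split; first exact: finitely_many_finType.
case; case; [exact: (finitely_many_finType unit)
  | exact: (finitely_many_finType void) | exact: (finitely_many_finType bool)
  | exact: (finitely_many_finType unit)].
Qed.

Section ParallelFunctor.
Variables (C : category) (a b : C) (g h : hom a b).

Definition parallel_ob (i : bool) : C := if i then b else a.

Definition parallel_map (i j : bool) :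
  pair_hom i j -> hom (parallel_ob i) (parallel_ob j).
Proof.
case: i j => [] [].
- by move=> _; exact: idm.
- by [].
- exact: (fun u : bool => if u then g else h).
- by move=> _; exact: idm.
Defined.

Definition parallel_functor : functor parallel_cat C.
Proof.
refine (@Functor parallel_cat C parallel_ob parallel_map _ _).
- by case.
- by case; case; case=> //= u v; rewrite ?comp1m ?compm1.
Defined.
End ParallelFunctor.

(** * Points of inverse images *)

Section GeometricPoints.
Variables (S : invSemigroupType) (X : topologicalType).
Local Notation L := (loganathan S).
Local Notation PSh := (classifying_topos S).
Local Notation presheaf := (functor (op_cat L) Sets).
Variable f : geometric_morphism (Sh X) PSh.
Local Notation G := (inverse_image f).
Local Notation R := (direct_image f).
Let eta := adj_unit (inverse_direct_adj f).
Let eps := adj_counit (inverse_direct_adj f).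

(** Right adjoints preserve monomorphisms; a map of sheaves that is injective
    on points is one. *)
Lemma direct_image_mono (U F : Sh X) (j : hom U F) (T : PSh)
    (t t' : hom T (R U)) :
  injective (app j) -> fmap R j \c t = fmap R j \c t' -> t = t'.
Proof.
move=> jinj jt.
have tE (s : hom T (R U)) : s = fmap R (eps U \c fmap G s) \c eta T.
  rewrite fmapM -compA -[_ \c eta T]/(fmap (R \of G) s \c eta T).
  rewrite -(naturality eta) compA.
  by rewrite (triangle_right (inverse_direct_adj f)) comp1m.
rewrite (tE t) (tE t'); congr (fmap R _ \c _).
have jE (s : hom T (R U)) : j \c (eps U \c fmap G s) =
    eps F \c fmap G (fmap R j \c s).
  rewrite fmapM !compA -[fmap G (fmap R j)]/(fmap (G \of R) j).
  by rewrite (naturality eps).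
apply: app_ext => z; apply: jinj; rewrite -!app_comp.
by rewrite (jE t) jt -jE.
Qed.

(** Inverse images preserve jointly surjective families. Let [j : U -> G Q] be
    the inclusion of the union of the images of the [ev q], which is open. Each
    [ev q] lifts to [U]; transposing these lifts gives a factorization [th] of
    the unit [eta Q] through [fmap R j], and the transpose of [th] is a section
    of [j]. *)
Lemma ev_cover (Q : presheaf) (z : pts G Q) :
  exists (c : L) (q : Q c) (a : pts G (yo c)), ev q a = z.
Proof.
pose U : set (pts G Q) := [set z | exists (c : L) (q : Q c) (a : pts G (yo c)),
  ev q a = z].
have oU : open U.
  apply: open_nearP => _ [c [q [a <-]]].
  have := over_open (ev_over G q) openT.
  move=> /open_near /(_ (ex_intro2 _ _ a I erefl)).
  by apply: filterS => _ [a' _ <-]; exists c, q, a'.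
pose UE : Sh X := open_etale oU.
pose j : hom UE (G Q) := exist _ _ (over_sval oU).
have jinj : injective (app j) by move=> y y' /sig_ext.
have kU (c : L) (q : Q c) a : U (ev q a) by exists c, q, a.
pose k (c : L) (q : Q c) : hom (G (yo c)) UE :=
  exist _ _ (over_corestrict oU (kU c q) (ev_over G q)).
have jk (c : L) (q : Q c) : j \c k c q = fmap G (yomap q : hom (yo c : PSh) Q).
  by apply: app_ext.
pose RU : presheaf := R UE.
pose theta (c : L) (q : Q c) : RU c :=
  (fmap R (k c q) \c eta (yo c) : nattrans _ _) c (idm c : yo c c).
have Rtheta (c : L) (q : Q c) :
    (fmap R j : nattrans _ _) c (theta c q) = (eta Q : nattrans _ _) c q.
  transitivity ((fmap R j \c (fmap R (k c q) \c eta (yo c)) : nattrans _ _) c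
    (idm c : yo c c)) => //.
  rewrite compA -fmapM jk.
  rewrite -[fmap R (fmap G _)]/(fmap (R \of G) (yomap q : hom (yo c : PSh) Q)).
  rewrite -(naturality eta) /=.
  by rewrite -[RHS](congr1 _ (res_idm q)).
(* Naturality of [theta] is inherited from [eta Q] along the injective
   [fmap R j]. *)
have RUinj (c : L) (u v : RU c) : (fmap R j : nattrans _ _) c u =
    (fmap R j : nattrans _ _) c v -> u = v.
  move=> uv; rewrite -(res_idm u) -(res_idm v).
  have uvE : yomap u = yomap v.
    apply: (direct_image_mono jinj); apply: psh_ext => d s.
    by rewrite /= !res_nat uv.
  exact: (congr1 (fun t : nattrans (yo c) RU => t c (idm c : yo c c)) uvE).
have theta_nat (c d : op_cat L) (u : hom c d) :
    theta d \o (fmap Q u : Q c -> Q d) = (fmap RU u : RU c -> RU d) \o theta c.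
  apply/funext => q; apply: RUinj; rewrite /= Rtheta.
  have := res_nat (fmap R j : nattrans _ _) (u : @hom L d c) (theta c q).
  rewrite /res /= => ->; rewrite Rtheta.
  exact: (res_nat (eta Q : nattrans _ _)).
pose th : hom (Q : PSh) (R UE) :=
  @NatTrans (op_cat L) Sets Q RU theta theta_nat.
have jth : fmap R j \c th = eta Q by apply: psh_ext => c q; exact: Rtheta.
have e : j \c (eps UE \c fmap G th) = idm (G Q).
  rewrite -(triangle_left (inverse_direct_adj f)) -jth fmapM !compA.
  by rewrite -[fmap G (fmap R j)]/(fmap (G \of R) j) (naturality eps).
have := svalP (app (eps UE \c fmap G th) z).
by have /(congr1 (fun h => app h z)) := e; rewrite app_comp app_idm /= => ->.
Qed.


Section Span.
Variables (I : finType) (c : I -> L).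

Let prod_map (d e : op_cat L) (u : hom d e) (q : forall i, yo (c i) d) :
  forall i, yo (c i) e := fun i => res u (q i).

Let prod_map1 (d : op_cat L) :
  prod_map (idm d) = (id : (forall i, yo (c i) d) -> _).
Proof.
by apply/funext => q; apply: functional_extensionality_dep => i; exact: res_idm.
Qed.

Let prod_mapM (d e g : op_cat L) (v : hom e g) (u : hom d e) :
  prod_map (v \c u) = prod_map v \o prod_map u.
Proof.
apply/funext => q; apply: functional_extensionality_dep => i.
exact: (@res_comp S (yo (c i)) d e g u v).
Qed.

Definition yo_prod : presheaf :=
  @Functor (op_cat L) Sets (fun d => forall i, yo (c i) d) prod_map
    prod_map1 prod_mapM.

Definition yo_proj (i : I) : nattrans yo_prod (yo (c i)) :=
  @NatTrans (op_cat L) Sets yo_prod (yo (c i)) (fun d q => q i)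
    (fun _ _ _ => erefl).

Let D : functor (discrete_cat I) PSh :=
  discrete_functor (fun i => yo (c i) : PSh).

Let prod_leg_nat (i j : discrete_cat I) (ij : hom i j) :
  fmap D ij \c (yo_proj i : @hom PSh yo_prod (yo (c i))) = yo_proj j.
Proof. by case: j / ij; exact: comp1m. Qed.

Let prod_cone : cone D :=
  @Cone (discrete_cat I) PSh D yo_prod yo_proj prod_leg_nat.

Let prod_cone_limit : is_limit prod_cone.
Proof.
move=> c'; pose T : presheaf := apex c'.
pose l i : nattrans T (yo (c i)) := leg c' i.
have mn (d e : op_cat L) (u : hom d e) :
    (fun t i => l i e t : yo (c i) e) \o (fmap T u : T d -> T e) =
    prod_map u \o (fun t i => l i d t).
  apply/funext => t; apply: functional_extensionality_dep => i.
  exact: (res_nat (l i)).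
exists (@NatTrans (op_cat L) Sets T yo_prod (fun d t i => l i d t) mn).
split=> [i|m ml]; first by apply: psh_ext.
apply: psh_ext => d t; apply: functional_extensionality_dep => i /=.
by rewrite /l -ml.
Qed.

(** The [a i] form a point of [G] of the product of the [yo (c i)], and the
    representable that covers this point is the apex of a span. *)
Lemma ev_span (x : X) (a : forall i, pts G (yo (c i))) :
  (forall i, proj (a i) = x) ->
  exists (d : L) (s : forall i, yo (c i) d) (b : pts G (yo d)),
    proj b = x /\ forall i, ev (s i) b = a i.
Proof.
move=> ax.
have := @inverse_image_lex _ _ f _ (discrete_cat_finite I) _ _ prod_cone_limit.
move=> /(stalk_limit_of_limit (discrete_cat_finite I)) /(_ x a ax).
case=> [i j ij|z [[zx zl] _]].
  by case: j / ij; rewrite /= (_ : fmap G _ = idm _) // -[RHS]fmap1.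
have [d [s [b bz]]] := ev_cover (z : pts G yo_prod).
exists d, s, b; split; first by rewrite -zx -bz proj_ev.
by move=> i; rewrite -zl -bz; exact/esym/(ev_nat (yo_proj i)).
Qed.

End Span.

Section Equalizer.
Variables (c : L) (Q : presheaf) (q q' : Q c).

Let eqz_ob (d : op_cat L) : Sets := {u : yo c d | res u q = res u q'}.

Let eqz_map_subproof (d e : op_cat L) (v : hom d e) (u : eqz_ob d) :
  res (res v (sval u)) q = res (res v (sval u)) q'.
Proof.
by have rc := @res_comp S Q c d e (sval u) v; rewrite [LHS]rc [RHS]rc (svalP u).
Qed.

Let eqz_map (d e : op_cat L) (v : hom d e) (u : eqz_ob d) : eqz_ob e :=
  exist _ (res v (sval u)) (eqz_map_subproof v u).

Let eqz_map1 (d : op_cat L) : eqz_map (idm d) = id.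
Proof. by apply/funext => u; apply: sig_ext; exact: res_idm. Qed.

Let eqz_mapM (d e g : op_cat L) (v : hom e g) (u : hom d e) :
  eqz_map (v \c u) = eqz_map v \o eqz_map u.
Proof.
by apply/funext => w; apply: sig_ext; exact: (@res_comp S (yo c) d e g u v).
Qed.

Definition yo_eqz : presheaf :=
  @Functor (op_cat L) Sets eqz_ob eqz_map eqz_map1 eqz_mapM.

Definition yo_eqz_incl : nattrans yo_eqz (yo c) :=
  @NatTrans (op_cat L) Sets yo_eqz (yo c) (fun d u => sval u)
    (fun _ _ _ => erefl).

Let D : functor parallel_cat PSh :=
  @parallel_functor PSh (yo c) Q (yomap q) (yomap q').

Let eqz_leg (i : parallel_cat) : @hom PSh yo_eqz (D i) :=
  match i with
  | false => yo_eqz_incl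
  | true => nt_comp (yomap q) yo_eqz_incl
  end.

Let eqz_leg_nat (i j : parallel_cat) (u : hom i j) :
  fmap D u \c eqz_leg i = eqz_leg j.
Proof.
case: i j u => [] [] u; rewrite /= ?nt_comp1m//; case: u => //.
by apply: psh_ext => d [v vq] /=.
Qed.

Let eqz_cone : cone D := Cone eqz_leg_nat.

Let eqz_cone_limit : is_limit eqz_cone.
Proof.
move=> c'; pose T : presheaf := apex c'.
pose l : nattrans T (yo c) := leg c' false.
have lE d (t : T d) : res (l d t) q = res (l d t) q'.
  have e u := congr1 (fun h : nattrans T Q => h d t)
    (@leg_nat _ _ _ c' false true u).
  by have := etrans (e true) (esym (e false)).
pose m d (t : T d) : eqz_ob d := exist _ (l d t) (lE d t).
have mn (d e : op_cat L) (u : hom d e) :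
    m e \o (fmap T u : T d -> T e) = eqz_map u \o m d.
  by apply/funext => t; apply: sig_ext; exact: (res_nat l).
exists (@NatTrans (op_cat L) Sets T yo_eqz m mn).
split=> [i|m' ml].
  have e0 : eqz_leg false \c
      (@NatTrans (op_cat L) Sets T yo_eqz m mn : @hom PSh T yo_eqz) =
      leg c' false by apply: psh_ext.
  case: i => //.
  rewrite -(@leg_nat _ _ _ eqz_cone false true true) -compA [X in _ \c X]e0.
  exact: leg_nat.
apply: psh_ext => d t; apply: sig_ext.
exact/esym/(congr1 (fun h : nattrans T (yo c) => h d t) (ml false)).
Qed.

(** [a] is a point of [G] of the equalizer of [q, q' : yo c -> Q]. *)
Lemma ev_eqz (a : pts G (yo c)) : ev q a = ev q' a ->
  exists (d : L) (u : yo c d) (b : pts G (yo d)),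
    ev u b = a /\ res u q = res u q'.
Proof.
move=> qa.
have := @inverse_image_lex _ _ f _ parallel_cat_finite _ _ eqz_cone_limit.
move=> /(stalk_limit_of_limit parallel_cat_finite) /(_ (proj a)).
pose z (i : parallel_cat) : pts G (D i) :=
  match i with false => a | true => ev q a end.
move=> /(_ z); case.
- by case=> //; exact: proj_ev.
- case=> [] [] u //.
  + by rewrite [fmap _ _](_ : _ = idm _) // -[RHS]fmap1.
  + by case: u.
  + by rewrite [fmap _ _](_ : _ = idm _) // -[RHS]fmap1.
move=> w [[wx wl] _].
have [d [s [b bw]]] := ev_cover (w : pts G yo_eqz).
exists d, (sval s), b; split; last exact: (svalP s).
rewrite -[RHS](wl false) -bw; exact/esym/(ev_nat yo_eqz_incl).
Qed.

End Equalizer.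

(** The product of [yo c] and [yo c'] followed by an equalizer: the points of a
    fibre product of representables. *)
Lemma ev_cospan (c c' : L) (Q : presheaf) (q : Q c) (q' : Q c')
    (a : pts G (yo c)) (a' : pts G (yo c')) : ev q a = ev q' a' ->
  exists (d : L) (u : yo c d) (u' : yo c' d) (b : pts G (yo d)),
    [/\ ev u b = a, ev u' b = a' & res u q = res u' q'].
Proof.
move=> qa; pose cc (i : bool) := if i then c else c'.
pose aa (i : bool) : pts G (yo (cc i)) :=
  match i with true => a | false => a' end.
have [|d [s [b [bx sb]]]] := @ev_span bool cc (proj a) aa.
  by case=> //=; rewrite -(proj_ev q a) qa proj_ev.
have sa : @ev S X G d (yo c) (s true) b = a := sb true.
have sa' : @ev S X G d (yo c') (s false) b = a' := sb false.
pose u : yo c d := s true; pose u' : yo c' d := s false.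
have [|e [v [b' [b'b vE]]]] := @ev_eqz d Q (res u q) (res u' q') b.
  by rewrite -(ev_res q u) -(ev_res q' u') sa sa' qa.
exists e, (res v u), (res v u'), b'; split.
- by rewrite -ev_res b'b.
- by rewrite -ev_res b'b.
- by rewrite (@res_comp S Q c d e u v) (@res_comp S Q c' d e u' v).
Qed.

(** The empty span, i.e. preservation of the terminal object. *)
Lemma ev_nonempty (x : X) : exists (c : L) (a : pts G (yo c)), proj a = x.
Proof.
have [|d [_ [b [bx _]]]] := @ev_span void (fun i => match i with end) x
  (fun i => match i with end); first by case.
by exists d, b.
Qed.

End GeometricPoints.

(** * Universal S-sets *)

Section InverseSemigroupOrder.
Variable S : invSemigroupType.
Implicit Types s t u e : S.
Local Open Scope group_scope.

Lemma nle_ranP s e : idem e -> nle (ran s) e <-> e * s = s.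
Proof.
move=> ee; split=> [[i ii rE]|es].
  by rewrite -{1}(ran_mul s) rE !mulgA ee -rE ran_mul.
by exists (ran s); [exact: ran_idem | rewrite /ran mulgA es].
Qed.

Lemma nle_idemM s e : idem e -> nle (e * s) s.
Proof.
by move=> ee; rewrite (idem_mul _ ee); apply: nle_idemr; exact: conj_idem.
Qed.

Lemma nle_mul_dom s t : nle s t -> t * dom s = s.
Proof.
move=> [e ee ->]; rewrite /dom sinvM (sinv_idem ee) -!mulgA (mulgA (sinv t)).
rewrite -/(dom t) (mulgA e) (idemC ee (dom_idem t)) -(mulgA (dom t)) ee.
by rewrite mulgA mul_dom.
Qed.

(** [dom s * u = u] says that [ran u <= dom s], i.e. that [s] is defined on [u]
    for the action by left multiplication. *)
Lemma dom_fixM s t u :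
  dom (s * t) * u = u <-> dom t * u = u /\ dom s * (t * u) = t * u.
Proof.
have tst : t * dom (s * t) = dom s * t.
  rewrite {1}/dom sinvM !mulgA -/(ran t) -(mulgA _ (sinv s)) -/(dom s).
  by rewrite (idemC (ran_idem t) (dom_idem s)) -mulgA ran_mul.
split=> [stu|[tu su]].
  have [k kk kE] := nle_domM s t.
  have dst : dom t * dom (s * t) = dom (s * t) by rewrite kE mulgA dom_idem.
  by split; [rewrite -{1}stu mulgA dst stu | rewrite mulgA -tst -mulgA stu].
by rewrite {1}/dom sinvM -!mulgA (mulgA (sinv s)) -/(dom s) su mulgA.
Qed.

End InverseSemigroupOrder.

Section SSetTheory.
Variables (S : invSemigroupType) (Y : Type) (mu : sset S Y).
Implicit Types (s t e : S) (y z : Y).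
Local Open Scope group_scope.

Lemma sset_mulP s t y z : mu (s * t) y z <-> exists2 w, mu t y w & mu s w z.
Proof. by rewrite gmulfM. Qed.

Lemma sset_invP s y z : mu (sinv s) y z <-> mu s z y.
Proof.
suff -> : mu (sinv s) = sinv (mu s) by [].
by apply: sinv_unique; rewrite -!gmulfM ?mulVK ?mulKV.
Qed.

Lemma sset_domP s y : pdom (mu s) y <-> mu (dom s) y y.
Proof.
split=> [[z yz]|/sset_mulP[z yz _]]; last by exists z.
by apply/sset_mulP; exists z => //; exact/sset_invP.
Qed.

Lemma sset_idem e y z : idem e -> mu e y z -> y = z.
Proof.
move=> ee yz; have : mu (e * e) y z by rewrite ee.
move=> /sset_mulP[w yw wz]; rewrite (graph_fun yw yz) in wz.
exact: graph_inj yz wz.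
Qed.

Lemma sset_nle s t y z : nle s t -> mu s y z -> mu t y z.
Proof. by move=> [e ee ->] /sset_mulP[w /(sset_idem ee) ->]. Qed.

(** The last clause says that an element that fixes a point is the identity
    near it: its restriction to some idempotent defined there is that
    idempotent. *)
Definition torsor : Prop :=
  [/\ exists y : Y, True, forall y z, exists s, mu s y z &
      forall s y, mu s y y -> exists e, [/\ idem e, nle e s & mu e y y]].

End SSetTheory.

Lemma torsor_equivalent (S : invSemigroupType) (Y Z : Type)
    (mu : sset S Y) (nu : sset S Z) :
  sset_equivalent mu nu -> torsor nu -> torsor mu.
Proof.
move=> [f [[g fK gK] fd fm]] [[z0 _] trans stab].
have fmV s y y' : nu s (f y) (f y') -> mu s y y'.
  move=> syy; have [y'' sy] : pdom (mu s) y by apply/fd; exists (f y').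
  have := graph_fun syy (fm _ _ _ sy); move=> /(congr1 g); rewrite !fK.
  by move=> ->.
split; first by exists (g z0).
  by move=> y z; have [s ?] := trans (f y) (f z); exists s; exact: fmV.
move=> s y /fm /stab[e [ee es ey]]; exists e; split=> //; exact: fmV.
Qed.

Section CosetTorsor.
Variables (S : invSemigroupType) (F : idem_filter S).
Local Notation H := (upfilter F).
Local Open Scope group_scope.

Lemma lcoset_idemr (x e : S) : idem e -> cis_set H e ->
  lcoset H (x * e) = lcoset H x.
Proof.
move=> ee He; apply/seteqP; split=> z [_ [h Hh <-] hz].
  by exists (x * (e * h)); [exists (e * h) => //; exact: cisM | rewrite mulgA].
exists (x * e * h); first by exists h.
apply: nle_trans hz; rewrite -mulgA; apply: nleM; first exact: nle_refl.
exact: nle_idemM.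
Qed.

(** If [s] fixes the coset of [x], then [x * h <= s * x] for some [h] in [H],
    and [h] may be taken to be an idempotent [e0] of the filter; then
    [x * e0 * sinv x] is an idempotent below [s] that fixes this coset. *)
Lemma coset_torsor : torsor (coset_sset H).
Proof.
split.
- have [e Fe] := idf_neq0 F; have ee := idf_idem Fe.
  suff c : is_coset H (lcoset H e) by exists (exist _ _ c).
  exists e => //; rewrite dom_of_idem//; exists e => //; exact: nle_refl.
- move=> [C [x Hx CE]] [C' [y Hy CE']].
  exists (y * sinv x), x; split=> //=.
  by rewrite -mulgA -/(dom x) lcoset_idemr//; exact: dom_idem.
- move=> s [C cC] [x [Hx /= CE CE']].
  have Hsx : cis_set H (dom (s * x)).
    by apply: is_coset_domM => //; rewrite -CE'.
  have : lcoset H x (s * x) by rewrite -CE CE'; exact: lcoset_self.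
  move=> [_ [h [e0 Fe0 e0h] <-] xh].
  have ee0 := idf_idem Fe0.
  have xe0 : nle (x * e0) (s * x).
    by apply: nle_trans xh; apply: nleM => //; exact: nle_refl.
  exists (x * e0 * sinv x); split.
  + by have := conj_idem (sinv x) ee0; rewrite sinvK.
  + apply: (@nle_trans _ _ (s * x * sinv x)).
      by apply: nleM => //; exact: nle_refl.
    by rewrite -mulgA -/(ran x); apply: nle_idemr; exact: ran_idem.
  + exists x; split=> //=; rewrite -(mulgA _ (sinv x)) -/(dom x).
    rewrite -mulgA (idemC ee0 (dom_idem x)) mulgA mul_dom lcoset_idemr//.
    by exists e0 => //; exact: nle_refl.
Qed.

End CosetTorsor.

Section TorsorUniversal.
Variables (S : invSemigroupType) (Y : Type) (mu : sset S Y).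
Hypothesis mu_torsor : torsor mu.
Variable y0 : Y.
Local Open Scope group_scope.

Let F0 : set S := [set e | idem e /\ mu e y0 y0].

Let F0_idem e : F0 e -> idem e. Proof. by case. Qed.

Let F0_neq0 : F0 !=set0.
Proof.
have [s /sset_domP sy] := sset_effective mu y0.
by exists (dom s); split=> //; exact: dom_idem.
Qed.

Let F0_up e f : F0 e -> idem f -> nle e f -> F0 f.
Proof. by move=> [ee ey] ff ef; split=> //; exact: sset_nle ey. Qed.

Let F0M e f : F0 e -> F0 f -> F0 (e * f).
Proof.
move=> [ee ey] [ff fy]; split; first exact: idemM.
by apply/sset_mulP; exists y0.
Qed.

Definition stab_filter : idem_filter S := IdemFilter F0_idem F0_neq0 F0_up F0M.
Local Notation H := (upfilter stab_filter).

(* The stabilizer of [y0] is the closure of its idempotents, by the last clause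
   of [torsor]. *)
Let stabP s : cis_set H s <-> mu s y0 y0.
Proof.
split=> [[e [ee ey] es]|sy]; first exact: sset_nle ey.
by have [_ _ /(_ _ _ sy)[e [ee es ey]]] := mu_torsor; exists e.
Qed.

(* The coset that corresponds to [y]. *)
Let fibre (y : Y) : set S := [set s | mu s y0 y].

Let fibreE x y : mu x y0 y -> fibre y = lcoset H x.
Proof.
move=> xy; apply/seteqP; split=> s.
  move=> sy; exists (x * (sinv x * s)).
    exists (sinv x * s) => //; apply/stabP/sset_mulP.
    by exists y => //; exact/sset_invP.
  by rewrite mulgA; apply: nle_idemM; exact: ran_idem.
move=> [_ [h /stabP hy <-] xhs]; apply: sset_nle xhs _.
by apply/sset_mulP; exists y0.
Qed.

Let fibre_coset y : is_coset H (fibre y).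
Proof.
have [_ /(_ y0 y) [x xy] _] := mu_torsor.
by exists x; [apply/stabP/sset_domP; exists y | exact: fibreE].
Qed.

Lemma torsor_universal : universal_sset mu.
Proof.
have [_ trans _] := mu_torsor.
exists stab_filter.
pose f y : coset H := exist _ (fibre y) (fibre_coset y).
have finj : injective f.
  move=> y z /(congr1 sval) /= yz; have [x xy] := trans y0 y.
  have xz : fibre z x by rewrite -yz.
  exact: graph_fun xy xz.
have fsurj C : exists y, f y = C.
  case: C => C cC; have [x Hx CE] := cC.
  have [y xy] : pdom (mu x) y0 by apply/sset_domP/stabP.
  by exists y; apply: sig_ext; rewrite /= CE; exact: fibreE.
have [g gP] := choice fsurj.
exists f; split.
- by exists g => // y; apply: finj.
- move=> s y; split.
    move=> [z yz]; have [x xy] := trans y0 y.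
    exists (f z), x; split=> /=; first by apply/stabP/sset_domP; exists y.
      exact: fibreE.
    by apply: fibreE; apply/sset_mulP; exists y.
  move=> [[C cC] [x [Hx /= yx CE]]].
  have Hsx : cis_set H (dom (s * x)) by apply: is_coset_domM => //; rewrite -CE.
  have [w /sset_mulP[v xv sv]] : pdom (mu (s * x)) y0 by apply/sset_domP/stabP.
  have xy : fibre y x by rewrite yx; exact: lcoset_self.
  by exists w; rewrite (graph_fun (xy : mu x y0 y) xv).
- move=> s y z yz; have [x xy] := trans y0 y.
  exists x; split=> /=; first by apply/stabP/sset_domP; exists y.
    exact: fibreE.
  by apply: fibreE; apply/sset_mulP; exists y.
Qed.

End TorsorUniversal.

Lemma universal_ssetP (S : invSemigroupType) (Y : Type) (mu : sset S Y) :
  universal_sset mu <-> torsor mu.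
Proof.
split=> [[F muF]|mut]; first exact: torsor_equivalent muF (coset_torsor F).
by have [[y _] _ _] := mut; exact: torsor_universal.
Qed.

(** * The bundle of a geometric morphism *)

Lemma papplyE (Y : Type) (g : pbij Y) y z : g y z -> papply g y = z.
Proof.
rewrite /papply; case: pselect => [h yz|h yz]; last by case: h; exists z.
by case: cid => w /= yw; exact: graph_fun yw yz.
Qed.

Lemma papplyP (Y : Type) (g : pbij Y) y : pdom g y -> g y (papply g y).
Proof. by move=> [z yz]; rewrite (papplyE yz). Qed.

Section ActionContinuity.
Variables (S : invSemigroupType) (T : topologicalType) (mu : sset S T).

(** [S] is discrete and the domains are open, so that joint continuity is
    continuity of each partial map. *)
Lemma act_continuousP : (forall s, open (pdom (mu s))) ->
  {within [set se : discrete_topology S * T | pdom (mu se.1) se.2],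
    continuous (fun se : discrete_topology S * T => papply (mu se.1) se.2)} <->
  forall s t, pdom (mu s) t -> {for t, continuous (papply (mu s))}.
Proof.
move=> mo; rewrite subspace_continuousP; split.
  move=> mc s t st.
  have := mc (s, t) st => {}mc A /= As.
  have : nbhs t [set t' | (pdom (mu s) t' -> A (papply (mu s) t'))].
    have [[B C] /= [Bs Ct] BC] := mc A As.
    apply: filterS Ct => t' Ct'.
    by apply: (BC (s, t')); split=> //; exact: nbhs_singleton Bs.
  move=> n; apply: filterS (near_and n (open_near (mo s) st)).
  by move=> t' [h /h].
move=> mc [s t] /= st A /= As.
have n := near_continuous (mc s t st) As.
exists ([set s], [set t' | A (papply (mu s) t')]).
  by split=> //=; rewrite nbhs_principalE; exact/principal_filterP.
by move=> [s' t'] [/= -> h] _.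
Qed.

End ActionContinuity.

Section UniversalPresheaf.
Variable S : invSemigroupType.
Local Notation L := (loganathan S).
Local Notation presheaf := (functor (op_cat L) Sets).

Let univ_ob (d : op_cat L) : Sets := {s : S | dom s = sval (d : L_ob S)}.

Let univ_map_subproof (d e : L) (u : L_hom e d) (s : univ_ob d) :
  dom (sval s * sval u)%g = sval e.
Proof. by case: u s => u [du ru] [s /= ds]; rewrite domM ?ds. Qed.

Let univ_map (d e : op_cat L) (u : @hom L e d) (s : univ_ob d) : univ_ob e :=
  exist _ (sval s * sval u)%g (univ_map_subproof u s).

Let univ_map1 (d : op_cat L) : univ_map (idm (d : L)) = id.
Proof.
apply/funext => -[s ds]; apply: sig_ext => /=.
by rewrite -[X in (s * X)%g]ds mul_dom.
Qed.

Let univ_mapM (d e g : op_cat L) (v : @hom L g e) (u : @hom L e d) :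
  univ_map (u \c v) = univ_map v \o univ_map u.
Proof. by apply/funext => s; apply: sig_ext; rewrite /= mulgA. Qed.

(** The universal [S]-set in presheaves: [S] itself, fibred over its idempotents
    by [dom], with the action by left multiplication. It is the colimit of the
    representables over the semilattice of idempotents. *)
Definition univ_psh : presheaf :=
  @Functor (op_cat L) Sets univ_ob univ_map univ_map1 univ_mapM.

Definition dom_ob (s : S) : L := exist _ (dom s) (dom_idem s).

Definition univ_dom (s : S) : univ_psh (dom_ob s) :=
  exist _ (dom s) (dom_of_idem (dom_idem s)).

Definition univ_elt (s : S) : univ_psh (dom_ob s) := exist _ s erefl.

(** [s * p] is defined when [ran p <= dom s], i.e. when [p] is an arrow into
    the object [dom s]; then [s * p] is the restriction of [s] along it. *)
Definition univ_arrow (s : S) (c : L) (p : univ_psh c)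
    (sp : (dom s * sval p = sval p)%g) :
  yo (dom_ob s) c :=
  exist _ (sval p) (conj (svalP p) ((nle_ranP (sval p) (dom_idem s)).2 sp)).

Definition univ_mul (s : S) (c : L) (p : univ_psh c)
    (sp : (dom s * sval p = sval p)%g) :
  univ_psh c := res (univ_arrow sp) (univ_elt s).

Lemma univ_mulE (s : S) (c : L) (p : univ_psh c)
    (sp : (dom s * sval p = sval p)%g) :
  sval (univ_mul sp) = (s * sval p)%g.
Proof. by []. Qed.

Lemma res_univ_dom (s : S) (c : L) (p : univ_psh c)
    (sp : (dom s * sval p = sval p)%g) :
  res (univ_arrow sp) (univ_dom s) = p.
Proof. by apply: sig_ext. Qed.

Lemma sval_res (c d : L) (u : yo c d) (p : univ_psh c) :
  sval (res u p) = (sval p * sval u)%g.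
Proof. by []. Qed.

End UniversalPresheaf.

Section BundleOfMorphism.
Variables (S : invSemigroupType) (X : topologicalType).
Local Notation L := (loganathan S).
Local Notation PSh := (classifying_topos S).
Variable f : geometric_morphism (Sh X) PSh.
Local Notation G := (inverse_image f).
Local Notation P := (univ_psh S).
Implicit Types s t : S.

(** The domain of [s] in [P] is [yo (dom_ob s)], included by the idempotent
    [dom s] and mapped to [P] by [s]; the graph of [s] on [f^* P] is the image
    of the corresponding pair of maps. *)
Definition bundle_act (s : S) (z w : pts G P) : Prop :=
  exists a : pts G (yo (dom_ob s)),
    ev (univ_dom s) a = z /\ ev (univ_elt s) a = w.

(** The graph may be tested on any representable on which [s * p] makes sense;
    this is the form that is stable under restriction. *)
Lemma bundle_actP s z w : bundle_act s z w <->
  exists (c : L) (p p' : P c) (a : pts G (yo c)),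
    [/\ (dom s * sval p = sval p)%g, sval p' = (s * sval p)%g,
        ev p a = z & ev p' a = w].
Proof.
split.
  move=> [a [az aw]]; exists (dom_ob s), (univ_dom s), (univ_elt s), a.
  split=> //=.
    by rewrite dom_idem.
  by rewrite mul_dom.
move=> [c [p [p' [a [sp p'E <- <-]]]]].
exists (ev (univ_arrow sp) a); rewrite !ev_res; split.
  by rewrite res_univ_dom.
by congr (ev _ a); apply: sig_ext.
Qed.

Lemma bundle_act_fun s z w w' : bundle_act s z w -> bundle_act s z w' -> w = w'.
Proof.
move=> /bundle_actP[c [p [q [a [sp qE pa qa]]]]].
move=> /bundle_actP[c' [p' [q' [a' [sp' qE' pa' qa']]]]].
have [|d [u [u' [b [ub ub' e]]]]] := @ev_cospan _ _ f _ _ P p p' a a'.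
  by rewrite pa.
rewrite -qa -qa' -ub -ub' !ev_res; congr (ev _ b); apply: sig_ext.
by rewrite !sval_res qE qE' -!mulgA -!sval_res e.
Qed.

Lemma bundle_act_inj s z z' w : bundle_act s z w -> bundle_act s z' w -> z = z'.
Proof.
move=> /bundle_actP[c [p [q [a [sp qE pa qa]]]]].
move=> /bundle_actP[c' [p' [q' [a' [sp' qE' pa' qa']]]]].
have [|d [u [u' [b [ub ub' e]]]]] := @ev_cospan _ _ f _ _ P q q' a a'.
  by rewrite qa.
rewrite -pa -pa' -ub -ub' !ev_res; congr (ev _ b); apply: sig_ext.
have e' : (s * (sval p * sval u) = s * (sval p' * sval u'))%g.
  by rewrite !mulgA -qE -qE' -!sval_res e.
by rewrite !sval_res -sp -sp' /dom -!mulgA e'.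
Qed.

Definition bundle_act_map s : pbij (pts G P) :=
  PBij (@bundle_act_fun s) (@bundle_act_inj s).

Let bundle_act_mapM : {morph bundle_act_map : s t / (s * t)%g}.
Proof.
move=> s t; apply: pbij_ext => z w; split.
  move=> /bundle_actP[c [p [q [a [/dom_fixM[tp sp] qE pa qa]]]]].
  exists (ev (univ_mul tp) a); apply/bundle_actP.
    by exists c, p, (univ_mul tp), a.
  by exists c, (univ_mul tp), q, a; split=> //; rewrite qE univ_mulE mulgA.
move=> [v /bundle_actP[c [p [q [a [tp qE pa qa]]]]]].
move=> /bundle_actP[c' [p' [q' [a' [sp' qE' pa' qa']]]]]; apply/bundle_actP.
have [|d [u [u' [b [ub ub' e]]]]] := @ev_cospan _ _ f _ _ P q p' a a'.
  by rewrite qa.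
have tpu : (t * (sval p * sval u) = sval (res u' p'))%g.
  by rewrite mulgA -qE -e.
exists d, (res u p), (res u' q'), b; split.
- rewrite sval_res; apply/dom_fixM; split; first by rewrite mulgA tp.
  by rewrite tpu sval_res mulgA sp'.
- by rewrite !sval_res qE' -!mulgA tpu sval_res.
- by rewrite -ev_res ub.
- by rewrite -ev_res ub'.
Qed.

HB.instance Definition _ := isMultiplicative.Build S (pbij (pts G P))
  bundle_act_map bundle_act_mapM.

Let bundle_act_effective (z : pts G P) : exists s, pdom (bundle_act_map s) z.
Proof.
have [c [p [a <-]]] := ev_cover z.
exists (ran (sval p)), (ev p a); apply/bundle_actP; exists c, p, p, a.
by rewrite dom_of_idem ?ran_mul//; exact: ran_idem.
Qed.

Definition bundle_act_sset : sset S (pts G P) :=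
  @SSet S (pts G P) bundle_act_map bundle_act_effective.

Lemma bundle_act_domP s z :
  pdom (bundle_act_sset s) z <-> exists a, ev (univ_dom s) a = z.
Proof.
split; first by move=> [w [a [az _]]]; exists a.
by move=> [a az]; exists (ev (univ_elt s) a), a.
Qed.

Lemma bundle_act_fibre s z w : bundle_act_sset s z w -> proj w = proj z.
Proof. by move=> [a [<- <-]]; rewrite !proj_ev. Qed.

Lemma bundle_act_inhabited x :
  exists2 z, stalk x z & exists s, pdom (bundle_act_sset s) z.
Proof.
have [c [a ax]] := ev_nonempty f x.
have dc : dom (sval c) = sval c by apply: dom_of_idem; exact: (svalP c).
exists (ev (exist _ (sval c) dc : P c) a); first by rewrite /stalk /= proj_ev.
exact: sset_effective.
Qed.

Lemma bundle_act_open s : open (pdom (bundle_act_sset s)).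
Proof.
have := over_open (ev_over G (univ_dom s)) openT; congr open.
apply/seteqP; split=> z.
  by move=> [a _ <-]; apply/bundle_act_domP; exists a.
by move=> /bundle_act_domP[a az]; exists a.
Qed.

(** Two points of a stalk are [ev p e] and [ev q e] for sections [p], [q] over
    one object, and [q * sinv p] carries the first to the second. If [s] fixes
    [ev p a], then after restriction [p = s * p], and [ran p] is an idempotent
    below [s]. *)
Lemma bundle_act_universal x : universal_sset (stalk_sset bundle_act_fibre x).
Proof.
apply/universal_ssetP; split.
- by have [z zx _] := bundle_act_inhabited x; exists (exist _ z zx).
- move=> [z zx] [w wx].
  have [c [p [a pa]]] := ev_cover z; have [c' [q [b qb]]] := ev_cover w.
  pose cc (i : bool) := if i then c else c'.
  pose aa (i : bool) : pts G (yo (cc i)) :=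
    match i with true => a | false => b end.
  have [|d [r [e [ex re]]]] := @ev_span _ _ f bool cc x aa.
    by case=> /=; [rewrite -(proj_ev p a) pa | rewrite -(proj_ev q b) qb].
  pose p' : P d := res (r true) p; pose q' : P d := res (r false) q.
  have p'e : ev p' e = z by rewrite /p' -ev_res re.
  have q'e : ev q' e = w by rewrite /q' -ev_res re.
  exists (sval q' * sinv (sval p'))%g; rewrite /=; apply/bundle_actP.
  have dpq : dom (sval p') = dom (sval q') by rewrite (svalP p') (svalP q').
  exists d, p', q', e; split=> //.
    apply/dom_fixM; split; first by rewrite /dom sinvK -/(ran _) ran_mul.
    by rewrite -/(dom (sval p')) -dpq dom_idem.
  by rewrite -mulgA -/(dom _) dpq mul_dom.
- move=> s [z zx] /= /bundle_actP[c [p [q [a [sp qE pa qa]]]]].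
  have [|d [u [b [ub e]]]] := @ev_eqz _ _ f c P p q a; first by rewrite pa.
  have {}e : (sval p * sval u)%g = (s * (sval p * sval u))%g.
    by rewrite mulgA -qE -!sval_res e.
  exists (ran (sval p * sval u)%g); split; first exact: ran_idem.
    by rewrite /ran {1}e -mulgA; apply: nle_idemr; exact: ran_idem.
  apply/bundle_actP; exists d, (res u p), (res u p), b.
  rewrite dom_of_idem; last exact: ran_idem.
  by rewrite !sval_res ran_mul; split=> //; rewrite -ev_res ub.
Qed.

(** Near a point of its domain the action of [s] is [ev (univ_elt s)] after a
    local inverse of the étale map [ev (univ_dom s)]. *)
Lemma bundle_act_continuous s z :
  pdom (bundle_act_sset s) z ->
  {for z, continuous (papply (bundle_act_sset s))}.
Proof.
move=> /bundle_act_domP[a az].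
have [g ga gs] := local_section a; rewrite -(proj_ev (univ_dom s)) az in ga gs.
have pz := @proj_continuous X (pts G P) z.
have gc : {for z, continuous (g \o @proj X (pts G P))}.
  by apply: continuous_comp => //; have [] := nbhs_singleton gs.
have sec : \forall z' \near z, ev (univ_dom s) (g (proj z')) = z'.
  apply: (@lifts_agree_near X _ _
    (ev (univ_dom s) \o (g \o @proj X (pts G P))) id).
  - apply: continuous_comp => //; exact: (over_continuous (ev_over G _)).
  - exact: cvg_id.
  - by rewrite /= ga.
  - apply: filterS (near_continuous pz gs) => z' [pg _].
    by rewrite /= proj_ev pg.
apply: (@continuous_near_eq _ _ _
  (ev (univ_elt s) \o (g \o @proj X (pts G P)))).
  by apply: filterS sec => z' e; apply: papplyE; exists (g (proj z')).
apply: continuous_comp => //; exact: (over_continuous (ev_over G _)).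
Qed.

Definition bundle_of : univ_bundle S X :=
  @UnivBundle S X (pts G P) bundle_act_sset
    bundle_act_inhabited bundle_act_open bundle_act_fibre bundle_act_universal
    ((act_continuousP bundle_act_open).2 bundle_act_continuous).

End BundleOfMorphism.

(** * The functor from geometric morphisms to bundles *)

Section BundleFunctor.
Variables (S : invSemigroupType) (X : topologicalType).
Local Notation L := (loganathan S).
Local Notation PSh := (classifying_topos S).
Local Notation presheaf := (functor (op_cat L) Sets).
Local Notation P := (univ_psh S).

Definition univ_id (c : L) : P c := exist _ (sval c) (dom_of_idem (svalP c)).

Lemma mul_univ_id (c d : L) (u : yo c d) : (sval c * sval u = sval u)%g.
Proof. by apply/nle_ranP; [exact: (svalP c) | exact: (svalP u).2]. Qed.

Lemma nat_ev (G G' : functor PSh (Sh X)) (t : nattrans G G') (c : L)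
    (Q : presheaf) (q : Q c) (a : pts G (yo c)) :
  app (t Q) (ev q a) = ev q (app (t (yo c)) a).
Proof. by rewrite /ev -!app_comp naturality. Qed.

Section UnivId.
Variable f : geometric_morphism (Sh X) PSh.
Local Notation G := (inverse_image f).

(** [univ_id c] is the inclusion of [yo c] in [P]; inverse images preserve its
    injectivity. *)
Lemma ev_univ_id_inj (c : L) : injective (ev (G := G) (univ_id c)).
Proof.
move=> a a' /ev_cospan[d [u [u' [b [<- <- /(congr1 sval)]]]]] /=.
by rewrite !mul_univ_id => /sig_ext ->.
Qed.

Lemma ev_univ_idP (c : L) z :
  pdom (act (bundle_of f) (sval c)) z <-> exists a, ev (univ_id c) a = z.
Proof.
have dc : dom (sval c) = sval c by apply: dom_of_idem; exact: (svalP c).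
split=> [[w /bundle_actP[d [p [p' [a [cp _ <- _]]]]]]|[a <-]].
  have rp : nle (ran (sval p)) (sval c).
    by apply/nle_ranP; [exact: (svalP c) | rewrite -{1}dc cp].
  pose u : yo c d := exist _ (sval p) (conj (svalP p) rp).
  exists (ev u a); rewrite ev_res; congr (ev _ a); apply: sig_ext => /=.
  by rewrite -[in LHS]dc cp.
exists (ev (univ_id c) a); apply/bundle_actP.
exists c, (univ_id c), (univ_id c), a.
by rewrite dc /= (svalP c : (_ * _)%g = _).
Qed.

(** Every map [p : yo c -> P] is recovered from the inclusion of [yo c] by the
    action of the element [p]. *)
Lemma act_ev (c : L) (p : P c) (a : pts G (yo c)) :
  act (bundle_of f) (sval p) (ev (univ_id c) a) (ev p a).
Proof.
apply/bundle_actP; exists c, (univ_id c), p, a; split=> //=.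
  by rewrite (svalP p); exact: (svalP c).
by rewrite -[X in (_ * X)%g](svalP p) mul_dom.
Qed.

End UnivId.

Section BundleMap.
Variables (f g : geometric_morphism (Sh X) PSh).
Variable t : nattrans (inverse_image f) (inverse_image g).

Lemma bundle_map_subproof : over (app (t P)) /\
  @equivariant S X (bundle_of f) (bundle_of g) (app (t P)).
Proof.
split=> [|s z w [a [<- <-]]]; first exact: app_over.
by exists (app (t (yo (dom_ob s))) a); rewrite !nat_ev.
Qed.

Definition bundle_map : univ_hom (bundle_of f) (bundle_of g) :=
  exist _ (app (t P)) bundle_map_subproof.

End BundleMap.

(** All presheaves are covered by representables, and these embed in [P]. *)
Lemma bundle_map_faithful (f g : geometric_morphism (Sh X) PSh)
    (t t' : nattrans (inverse_image f) (inverse_image g)) :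
  bundle_map t = bundle_map t' -> t = t'.
Proof.
move=> /(congr1 sval) /= tt'; apply: nattrans_ext => Q.
apply: app_ext => z; have [c [q [a <-]]] := ev_cover z.
rewrite !nat_ev; congr (ev q _); apply: (@ev_univ_id_inj g c).
by rewrite -!nat_ev tt'.
Qed.

(** An equivariant [h] respects the domains of the idempotents, hence restricts
    to a map [lifts] on each representable. By [act_ev] these restrictions are
    compatible with the arrows between representables, and so they determine
    the component [ext] at any presheaf. *)
Section BundleMapFull.
Variables (f g : geometric_morphism (Sh X) PSh).
Local Notation F := (inverse_image f).
Local Notation G := (inverse_image g).
Variable h : univ_hom (bundle_of f) (bundle_of g).

Let ho : over (sval h) := (svalP h).1.
Let he : equivariant (sval h) := (svalP h).2.

Let lifts (c : L) (a : pts F (yo c)) (a' : pts G (yo c)) : Prop :=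
  ev (univ_id c) a' = sval h (ev (univ_id c) a).

Let lift_ex (c : L) (a : pts F (yo c)) : exists a', lifts a a'.
Proof.
apply/ev_univ_idP.
have [w aw] : pdom (act (bundle_of f) (sval c)) (ev (univ_id c) a).
  by apply/ev_univ_idP; exists a.
by exists (sval h w); exact: he aw.
Qed.

Let lifts_ev (c : L) (a : pts F (yo c)) (a' : pts G (yo c)) (p : P c) :
  lifts a a' -> ev p a' = sval h (ev p a).
Proof.
move=> aa'; have := he (act_ev p a); rewrite -aa'.
exact: graph_fun (act_ev p a').
Qed.

Let lifts_res (c d : L) (u : yo c d) (b : pts F (yo d)) (b' : pts G (yo d)) :
  lifts b b' -> lifts (ev u b) (ev u b').
Proof. by move=> bb'; rewrite /lifts !ev_res; exact: lifts_ev. Qed.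

Let lifts_fun (c : L) (a : pts F (yo c)) (a' a'' : pts G (yo c)) :
  lifts a a' -> lifts a a'' -> a' = a''.
Proof. by move=> aa' aa''; apply: (@ev_univ_id_inj g c); rewrite aa' aa''. Qed.

Let ext (Q : presheaf) (z : pts F Q) (w : pts G Q) : Prop :=
  exists (c : L) (q : Q c) (a : pts F (yo c)) (a' : pts G (yo c)),
    [/\ ev q a = z, lifts a a' & ev q a' = w].

Let ext_ex (Q : presheaf) (z : pts F Q) : exists w, ext z w.
Proof.
have [c [q [a az]]] := ev_cover z; have [a' aa'] := lift_ex a.
by exists (ev q a'), c, q, a, a'.
Qed.

Let ext_fun (Q : presheaf) (z : pts F Q) (w w' : pts G Q) :
  ext z w -> ext z w' -> w = w'.
Proof.
move=> [c [q [a [a' [az aa' <-]]]]] [d [r [b [b' [bz bb' <-]]]]].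
have [|e [u [u' [k [ka kb uu']]]]] := @ev_cospan _ _ f _ _ Q q r a b.
  by rewrite az.
have [k' kk'] := lift_ex k.
have -> : a' = ev u k' by apply: lifts_fun aa' _; rewrite -ka; exact: lifts_res.
have -> : b' = ev u' k'.
  by apply: lifts_fun bb' _; rewrite -kb; exact: lifts_res.
by rewrite !ev_res uu'.
Qed.

Let extf (Q : presheaf) (z : pts F Q) : pts G Q := sval (cid (ext_ex z)).

Let extfP (Q : presheaf) (z : pts F Q) : ext z (extf z).
Proof. exact: svalP (cid (ext_ex z)). Qed.

Let extfE (Q : presheaf) (z : pts F Q) w : ext z w -> extf z = w.
Proof. exact: ext_fun. Qed.

Let proj_lift (c : L) (a : pts F (yo c)) (a' : pts G (yo c)) :
  lifts a a' -> proj a' = proj a.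
Proof. by move=> aa'; rewrite -(proj_ev (univ_id c) a') aa' ho.2 proj_ev. Qed.

(* Continuity: near [z] the map is [ev q] after a section through [a']. *)
Let extf_over (Q : presheaf) : over (@extf Q).
Proof.
split=> z; last first.
  have [c [q [a [a' [<- /proj_lift aa' <-]]]]] := extfP z.
  by rewrite !proj_ev.
have [c [q [a [a' [az aa' zw]]]]] := extfP z.
have px : proj a = proj z by rewrite -az proj_ev.
have px' : proj a' = proj z by rewrite (proj_lift aa').
have [k ka ks] := local_section a; rewrite px in ka ks.
have [k' ka' ks'] := local_section a'; rewrite px' in ka' ks'.
have pz := @proj_continuous X (pts F Q) z.
have kc : {for z, continuous (k \o @proj X (pts F Q))}.
  by apply: continuous_comp => //; have [] := nbhs_singleton ks.
have kc' : {for z, continuous (k' \o @proj X (pts F Q))}.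
  by apply: continuous_comp => //; have [] := nbhs_singleton ks'.
have n1 : \forall z' \near z, ev q (k (proj z')) = z'.
  apply: (@lifts_agree_near X _ _ (ev q \o (k \o @proj X (pts F Q))) id).
  - apply: continuous_comp => //; exact: (over_continuous (ev_over F q)).
  - exact: cvg_id.
  - by rewrite /= ka.
  - apply: filterS (near_continuous pz ks) => z' [pk _].
    by rewrite /= proj_ev pk.
have n2 : \forall z' \near z, lifts (k (proj z')) (k' (proj z')).
  apply: (@lifts_agree_near X _ _ (ev (univ_id c) \o (k' \o @proj X (pts F Q)))
    (sval h \o (ev (univ_id c) \o (k \o @proj X (pts F Q))))).
  - apply: continuous_comp => //; exact: (over_continuous (ev_over G _)).
  - apply: continuous_comp; last exact: (over_continuous ho).
    apply: continuous_comp => //; exact: (over_continuous (ev_over F _)).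
  - by rewrite /= ka ka'.
  - apply: filterS (near_and (near_continuous pz ks) (near_continuous pz ks')).
    by move=> z' [[pk _] [pk' _]]; rewrite /= ho.2 !proj_ev pk pk'.
apply: (@continuous_near_eq _ _ _ (ev q \o (k' \o @proj X (pts F Q)))).
  apply: filterS (near_and n1 n2) => z' [e1 e2]; apply: extfE.
  by exists c, q, (k (proj z')), (k' (proj z')).
apply: continuous_comp => //; exact: (over_continuous (ev_over G _)).
Qed.

Let ext_component (Q : PSh) : hom (F Q) (G Q) := exist _ _ (@extf_over Q).

Let ext_nat (Q Q' : PSh) (t : hom Q Q') :
  ext_component Q' \c fmap F t = fmap G t \c ext_component Q.
Proof.
apply: app_ext => z; rewrite !app_comp; apply: extfE.
have [c [q [a [a' [az aa' zw]]]]] := extfP z.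
exists c, ((t : nattrans _ _) c q), a, a'; split=> //.
  by rewrite -az; exact/esym/(ev_nat (t : nattrans _ _)).
by rewrite -[app (ext_component Q) z]zw; exact/esym/(ev_nat (t : nattrans _ _)).
Qed.

Lemma bundle_map_full : exists t, bundle_map t = h.
Proof.
exists (NatTrans ext_nat); apply: sig_ext; apply/funext => z.
apply: extfE; have [c [q [a az]]] := ev_cover z; have [a' aa'] := lift_ex a.
by exists c, q, a, a'; split=> //; rewrite -az; exact: lifts_ev.
Qed.

End BundleMapFull.

Definition bundle_functor : functor (Geom (Sh X) PSh) (Univ S X).
Proof.
refine (@Functor (Geom (Sh X) PSh) (Univ S X) (@bundle_of S X)
  (@bundle_map) _ _).
- by move=> f; apply: sig_ext.
- by move=> f g k t s; apply: sig_ext.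
Defined.

End BundleFunctor.

(** * The geometric morphism of a flat functor *)

Section Tensor.
Variables (S : invSemigroupType) (X : topologicalType).
Local Notation L := (loganathan S).
Local Notation PSh := (classifying_topos S).
Local Notation presheaf := (functor (op_cat L) Sets).
Variable A : functor L (Sh X).

Definition shf (c : L) : etale_space X := A c.
Definition push (c d : L) (u : hom d c) : shf d -> shf c := app (fmap A u).

Lemma push_over (c d : L) (u : hom d c) : over (push u).
Proof. exact: app_over. Qed.

Lemma push_idm (c : L) (a : shf c) : push (idm c) a = a.
Proof. by rewrite /push fmap1. Qed.

Lemma push_comp (c d e : L) (u : hom d c) (v : hom e d) (a : shf e) :
  push (u \c v) a = push u (push v a).
Proof. by rewrite /push fmapM. Qed.

Lemma proj_push (c d : L) (u : hom d c) (a : shf d) : proj (push u a) = proj a.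
Proof. exact: proj_app. Qed.

Section TensorPoints.
Variable Q : presheaf.

Record triple : Type := Triple {
  tob : L_ob S;
  tsec : Q tob;
  tpt : shf tob
}.

(** A common refinement of the two triples. This is transitive as soon as [A]
    is flat. *)
Definition triple_eq (t t' : triple) : Prop :=
  exists (e : L) (u : hom e (tob t)) (v : hom e (tob t')) (z : shf e),
    [/\ push u z = tpt t, push v z = tpt t' & res u (tsec t) = res v (tsec t')].

Definition tensor : Type := {C : set triple | exists t, C = triple_eq t}.

Definition cls (t : triple) : tensor := exist _ _ (ex_intro _ t erefl).

Definition tin (c : L) (q : Q c) (a : shf c) : tensor := cls (@Triple c q a).

HB.instance Definition _ := gen_eqMixin tensor.
HB.instance Definition _ := gen_choiceMixin tensor.

(** The final topology for the maps [tin q]. *)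
Definition tensor_open : set_system tensor :=
  [set W | forall (c : L) (q : Q c), open [set a : shf c | W (tin q a)]].

Let tensor_openT : tensor_open setT.
Proof. by move=> c q; exact: openT. Qed.

Let tensor_openI : setI_closed tensor_open.
Proof. by move=> V W Vo Wo c q; exact: (openI (Vo c q) (Wo c q)). Qed.

Let tensor_open_bigU (I : Type) (W : I -> set tensor) :
  (forall i, tensor_open (W i)) -> tensor_open (\bigcup_i W i).
Proof.
move=> Wo c q; rewrite (_ : [set a | _] = \bigcup_i [set a | W i (tin q a)]).
  by apply: bigcup_open => i _; exact: Wo.
by apply/seteqP; split=> a [i _ ia]; exists i.
Qed.

HB.instance Definition _ :=
  isOpenTopological.Build tensor tensor_openT tensor_openI tensor_open_bigU.

Lemma open_tensorE (W : set tensor) : open W = tensor_open W.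
Proof. by []. Qed.

Lemma tensorP (C : tensor) : exists (c : L) (q : Q c) (a : shf c), C = tin q a.
Proof. by case: C => C [[c q a] CE]; exists c, q, a; exact: sig_ext. Qed.

Lemma tin_continuous (c : L) (q : Q c) : continuous (tin q).
Proof. by apply/continuousP => W; rewrite open_tensorE; apply. Qed.

Lemma tensor_continuous (T : topologicalType) (h : tensor -> T) :
  (forall (c : L) (q : Q c), continuous (h \o tin q)) -> continuous h.
Proof.
move=> hc; apply/continuousP => V oV; rewrite open_tensorE => c q.
by have /continuousP/(_ V oV) := hc c q.
Qed.

End TensorPoints.

(** Filteredness, at each point of [X], of the category of elements. *)
Definition flat : Prop :=
  [/\ forall x, exists (c : L) (a : shf c), proj a = x,
      forall (c d : L) (a : shf c) (b : shf d), proj a = proj b ->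
        exists (e : L) (u : hom e c) (v : hom e d) (z : shf e),
          push u z = a /\ push v z = b &
      forall (c d : L) (u v : hom d c) (a : shf d), push u a = push v a ->
        exists (e : L) (w : hom e d) (z : shf e),
          push w z = a /\ u \c w = v \c w].

Hypothesis A_flat : flat.

Lemma flat_cospan (c d e : L) (u : hom d c) (v : hom e c)
    (a : shf d) (b : shf e) :
  push u a = push v b ->
  exists (k : L) (s : hom k d) (t : hom k e) (z : shf k),
    [/\ push s z = a, push t z = b & u \c s = v \c t].
Proof.
move=> ab; have [_ span equ] := A_flat.
have [|k [s [t [z [sz tz]]]]] := span _ _ a b.
  by rewrite -(proj_push u) ab proj_push.
have [|m [w [y [wy uv]]]] := equ _ _ (u \c s) (v \c t) z.
  by rewrite !push_comp sz tz.
by exists m, (s \c w), (t \c w), y; rewrite !push_comp wy !compA.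
Qed.

Section TensorEq.
Variable Q : presheaf.

Lemma triple_eq_refl (t : triple Q) : triple_eq t t.
Proof. by exists (tob t), (idm _), (idm _), (tpt t); rewrite push_idm. Qed.

Lemma triple_eq_sym (t t' : triple Q) : triple_eq t t' -> triple_eq t' t.
Proof. by move=> [e [u [v [z [uz vz uv]]]]]; exists e, v, u, z. Qed.

Lemma triple_eq_trans (t t' t'' : triple Q) :
  triple_eq t t' -> triple_eq t' t'' -> triple_eq t t''.
Proof.
move=> [e [u [v [z [uz vz uv]]]]] [e' [u' [v' [z' [uz' vz' uv']]]]].
have [|k [s [s' [y [sy sy' vu]]]]] := @flat_cospan _ _ _ v u' z z'.
  by rewrite vz.
exists k, (u \c s), (v' \c s'), y; rewrite !push_comp sy sy'; split=> //.
by rewrite !res_comp uv -uv' -!res_comp vu.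
Qed.

Lemma cls_eq (t t' : triple Q) : cls t = cls t' <-> triple_eq t t'.
Proof.
split=> [/(congr1 sval) /= tt'|tt'].
  by rewrite tt'; exact: triple_eq_refl.
apply: sig_ext; apply/seteqP; split=> s /=; last exact: triple_eq_trans.
by apply: triple_eq_trans; exact: triple_eq_sym.
Qed.

Lemma tin_push (c d : L) (q : Q c) (u : hom d c) (a : shf d) :
  tin q (push u a) = tin (res u q) a.
Proof.
apply/cls_eq; exists d, u, (idm d), a => /=.
by rewrite push_idm res_idm.
Qed.

Lemma tin_eq (c : L) (q q' : Q c) (a : shf c) : tin q a = tin q' a ->
  exists (d : L) (u : hom d c) (b : shf d), push u b = a /\ res u q = res u q'.
Proof.
move=> /cls_eq[d [u [v [z /= [uz vz uv]]]]].
have [|e [s [t [y [sy ty us]]]]] := @flat_cospan _ _ _ u v z z.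
  by rewrite uz.
have [_ _ /(_ _ _ s t y)[|k [w [y' [wy st]]]]] := A_flat; first by rewrite sy.
exists k, (u \c (s \c w)), y'; rewrite !push_comp wy sy; split=> //.
have uvw : u \c (s \c w) = v \c (s \c w) by rewrite [in RHS]st !compA us.
by rewrite res_comp uv -res_comp -uvw.
Qed.

(** By the form of [triple_eq], the inverse image of [tin q @` U] under another
    [tin r] is a union of images of open sets under maps [push v]. *)
Lemma tin_open (c : L) (q : Q c) (U : set (shf c)) :
  open U -> open (tin q @` U).
Proof.
move=> oU; rewrite open_tensorE => d r; apply: open_nearP => b [a Ua].
move=> /cls_eq[e [u [v [z /= [uz vz uv]]]]].
have oUu : open (push u @^-1` U).
  by apply: open_comp => // y _; exact: (over_continuous (push_over u)).
have : (push v @` (push u @^-1` U)) b by exists z => //=; rewrite uz.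
move=> /(open_near (over_open (push_over v) oUu)); apply: filterS.
move=> _ [y Uy <-]; exists (push u y) => //.
by rewrite !tin_push uv.
Qed.

Definition tlift (T : Type) (h : triple Q -> T) (C : tensor Q) : T :=
  h (sval (cid (svalP C))).

Lemma tliftE (T : Type) (h : triple Q -> T) (t : triple Q) :
  (forall t t', triple_eq t t' -> h t = h t') -> tlift h (cls t) = h t.
Proof.
move=> hh; apply: hh; apply/triple_eq_sym/cls_eq/sig_ext => /=.
exact: svalP (cid (svalP (cls t))).
Qed.

Let tproj_eq (t t' : triple Q) : triple_eq t t' -> proj (tpt t) = proj (tpt t').
Proof. by move=> [e [u [v [z [<- <- _]]]]]; rewrite !proj_push. Qed.

Definition tproj : tensor Q -> X := tlift (fun t => proj (tpt t)).

Lemma tproj_tin (c : L) (q : Q c) (a : shf c) : tproj (tin q a) = proj a.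
Proof. by rewrite /tproj (tliftE _ tproj_eq). Qed.

Lemma tensor_local_homeo : local_homeomorphism tproj.
Proof.
apply: local_homeomorphism_intro.
- apply: tensor_continuous => c q a.
  rewrite (_ : _ \o _ = @proj X (shf c)); first exact: proj_continuous.
  by apply/funext => b; exact: tproj_tin.
- move=> W oW; apply: open_nearP => _ [C WC <-].
  have [c [q [a CE]]] := tensorP C; rewrite CE tproj_tin.
  have oWq : open [set a : shf c | W (tin q a)] := oW c q.
  have : (@proj X (shf c) @` [set a : shf c | W (tin q a)]) (proj a).
    by exists a; rewrite //= -CE.
  move=> /(open_near (proj_open oWq)); apply: filterS => _ [b Wb <-].
  by exists (tin q b) => //; exact: tproj_tin.
- move=> C; have [c [q [a ->]]] := tensorP C.
  have [U [oU Ua] Uinj] := proj_near_inj a.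
  exists (tin q @` U); first by split; [exact: tin_open | exists a].
  move=> _ _ [b Ub <-] [b' Ub' <-]; rewrite !tproj_tin => bb'.
  by rewrite (Uinj _ _ Ub Ub' bb').
Qed.

Definition tensor_etale : etale_space X := EtaleSpace tensor_local_homeo.

Lemma tin_over (c : L) (q : Q c) : over (tin q : shf c -> tensor_etale).
Proof. by split; [exact: tin_continuous | exact: tproj_tin]. Qed.

Lemma tlift_over (E : etale_space X) (h : triple Q -> E) :
  (forall t t', triple_eq t t' -> h t = h t') ->
  (forall (c : L) (q : Q c), over (fun a : shf c => h (Triple q a))) ->
  over (tlift h : tensor_etale -> E).
Proof.
move=> hh ho; split.
  apply: tensor_continuous => c q a; have [+ _] := ho c q; move=> /(_ a).
  by congr continuous_at; apply/funext => b; rewrite /= /tin tliftE.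
move=> C; have [c [q [a ->]]] := tensorP C.
rewrite /tin tliftE// (ho c q).2; exact/esym/tproj_tin.
Qed.

End TensorEq.

Section TensorMap.
Variables (Q Q' : presheaf) (t : nattrans Q Q').

Let tmap_fun (s : triple Q) : tensor_etale Q' := tin (t _ (tsec s)) (tpt s).

Let tmap_fun_eq (s s' : triple Q) : triple_eq s s' -> tmap_fun s = tmap_fun s'.
Proof.
move=> [e [u [v [z [uz vz uv]]]]].
rewrite /tmap_fun -uz -vz !tin_push; congr (tin _ z).
by rewrite -!(res_nat t) uv.
Qed.

Definition tmap : @hom (Sh X) (tensor_etale Q) (tensor_etale Q') :=
  exist _ (tlift tmap_fun)
    (tlift_over tmap_fun_eq (fun c q => tin_over (t c q))).

Lemma tmap_tin (c : L) (q : Q c) (a : shf c) :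
  app tmap (tin q a) = tin (t c q) a.
Proof. by rewrite /app /= /tin tliftE. Qed.

End TensorMap.

Lemma tensor_hom_ext (Q : presheaf) (E : Sh X)
    (g h : @hom (Sh X) (tensor_etale Q) E) :
  (forall (c : L) (q : Q c) (a : shf c), app g (tin q a) = app h (tin q a)) ->
  g = h.
Proof. by move=> gh; apply: app_ext => C; have [c [q [a ->]]] := tensorP C. Qed.

Definition tensor_functor : functor PSh (Sh X).
Proof.
refine (@Functor PSh (Sh X) tensor_etale tmap _ _).
- by move=> Q; apply: tensor_hom_ext => c q a; rewrite tmap_tin.
- move=> Q Q' Q'' t s; apply: tensor_hom_ext => c q a.
  by rewrite app_comp !tmap_tin.
Defined.

Section DirectImage.
Variable E : etale_space X.

Let di_ob (c : op_cat L) : Sets := {h : shf c -> E | over h}.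

Let di_map (c d : op_cat L) (u : @hom L d c) (h : di_ob c) : di_ob d :=
  exist _ (sval h \o push u) (over_comp (svalP h) (push_over u)).

Let di_map1 (c : op_cat L) : di_map (idm (c : L)) = id.
Proof.
apply/funext => h; apply: sig_ext; apply/funext => a /=.
by rewrite push_idm.
Qed.

Let di_mapM (c d e : op_cat L) (v : @hom L e d) (u : @hom L d c) :
  di_map (u \c v) = di_map v \o di_map u.
Proof.
by apply/funext => h; apply: sig_ext; apply/funext => a; rewrite /= push_comp.
Qed.

(** The right adjoint of the tensor product with [A]. *)
Definition sections : presheaf :=
  @Functor (op_cat L) Sets di_ob di_map di_map1 di_mapM.

Lemma sections_res (c d : L) (u : hom d c) (h : sections c) (a : shf d) :
  sval (res u h) a = sval h (push u a).
Proof. by []. Qed.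

End DirectImage.

Section SectionsMap.
Variables (E F : Sh X) (g : hom E F).

Let sections_map_fun (c : op_cat L) (h : sections E c) : sections F c :=
  exist _ (app g \o sval h) (over_comp (app_over g) (svalP h)).

Definition sections_map : nattrans (sections E) (sections F).
Proof.
refine (@NatTrans (op_cat L) Sets (sections E) (sections F) sections_map_fun _).
by move=> c d u; apply/funext => h; exact: sig_ext.
Defined.

End SectionsMap.

Definition sections_functor : functor (Sh X) PSh.
Proof.
refine (@Functor (Sh X) PSh sections sections_map _ _).
- by move=> E; apply: psh_ext => c h; apply: sig_ext.
- by move=> E F F' g h; apply: psh_ext => c k; apply: sig_ext.
Defined.

(* The unit sends [q] to [tin q], the counit evaluates a section at a point. *)
Let unit_component (Q : presheaf) : nattrans Q (sections (tensor_etale Q)).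
Proof.
refine (@NatTrans (op_cat L) Sets Q (sections (tensor_etale Q))
  (fun c q => exist _ (tin q) (tin_over q)) _).
move=> c d u; apply/funext => q; apply: sig_ext; apply/funext => a.
exact/esym/tin_push.
Defined.

Let tensor_unit :
  nattrans (id_functor PSh) (sections_functor \of tensor_functor).
Proof.
refine (@NatTrans PSh PSh (id_functor PSh) (sections_functor \of tensor_functor)
  unit_component _).
move=> Q Q' t; apply: psh_ext => c q; apply: sig_ext; apply/funext => a.
exact/esym/(tmap_tin t).
Defined.

Let counit_fun (E : etale_space X) (t : triple (sections E)) : E :=
  sval (tsec t) (tpt t).

Let counit_fun_eq (E : etale_space X) (t t' : triple (sections E)) :
  triple_eq t t' -> counit_fun t = counit_fun t'.
Proof.
move=> [e [u [v [z [uz vz uv]]]]].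
by rewrite /counit_fun -uz -vz -!sections_res uv.
Qed.

Let counit_component (E : Sh X) : @hom (Sh X) (tensor_etale (sections E)) E :=
  exist _ (tlift (@counit_fun E))
    (tlift_over (@counit_fun_eq E) (fun c q => svalP q)).

Let counit_tin (E : Sh X) (c : L) (h : sections E c) (a : shf c) :
  app (counit_component E) (tin h a) = sval h a.
Proof. by rewrite /app /= /tin (tliftE _ (@counit_fun_eq E)). Qed.

Let tensor_counit :
  nattrans (tensor_functor \of sections_functor) (id_functor (Sh X)).
Proof.
refine (@NatTrans (Sh X) (Sh X) (tensor_functor \of sections_functor)
  (id_functor (Sh X)) counit_component _).
move=> E F g; apply: tensor_hom_ext => c h a.
transitivity (app g (sval h a)); last first.
  exact: esym (congr1 (app g) (counit_tin _ _)).
have e := tmap_tin (sections_map g) h a.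
exact: etrans (congr1 (app (counit_component F)) e) (counit_tin _ _).
Defined.

Definition tensor_adjunction : adjunction tensor_functor sections_functor.
Proof.
refine (@Adjunction _ _ _ _ tensor_unit tensor_counit _ _).
- move=> Q; apply: tensor_hom_ext => c q a.
  transitivity (app (counit_component (tensor_etale Q))
      (tin (unit_component Q c q) a)); last exact: counit_tin.
  exact: (congr1 (app (counit_component _)) (tmap_tin (unit_component Q) q a)).
- move=> E; apply: psh_ext => c h; apply: sig_ext; apply/funext => a.
  exact: counit_tin.
Defined.

End Tensor.

(** Finite limits are preserved because the category of elements is filtered at
    each point: finitely many conditions that can each be met by refining can
    be met together. *)
Section TensorLex.
Variables (S : invSemigroupType) (X : topologicalType).
Local Notation L := (loganathan S).
Local Notation PSh := (classifying_topos S).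
Local Notation presheaf := (functor (op_cat L) Sets).
Variable A : functor L (Sh X).
Hypothesis A_flat : flat A.
Local Notation shf := (shf A).
Local Notation T := (tensor_functor A_flat).

Section Refinement.
Variables (d : L) (b : shf d).

(** A property of the refinements [w : e -> d], [push w z = b], of the object
    [(d, b)] of the category of elements. *)
Definition condition : Type := forall e : L, hom e d -> shf e -> Prop.

Definition stable (P : condition) : Prop := forall e w z e' (u : hom e' e) z',
  P e w z -> push u z' = z -> P e' (w \c u) z'.

Definition dense (P : condition) : Prop := forall e w z, push w z = b ->
  exists e' (u : hom e' e) (z' : shf e'), push u z' = z /\ P e' (w \c u) z'.

Lemma stable_all (I : Type) (P : I -> condition) :
  (forall i, stable (P i)) -> stable (fun e w z => forall i, P i e w z).
Proof. by move=> Ps e w z e' u z' Pz uz i; exact: Ps (Pz i) uz. Qed.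

(** The conditions are met one after the other; stability keeps those that are
    already met. *)
Lemma dense_all (I : Type) (P : I -> condition) : finitely_many I ->
  (forall i, stable (P i)) -> (forall i, dense (P i)) ->
  dense (fun e w z => forall i, P i e w z).
Proof.
move=> [n [h hs]] Ps Pd.
suff Q e w z : push w z = b -> exists e' (u : hom e' e) (z' : shf e'),
    push u z' = z /\ forall k, P (h k) e' (w \c u) z'.
  move=> e w z /Q[e' [u [z' [uz Pz]]]]; exists e', u, z'; split=> // i.
  by have [k <-] := hs i.
elim: n h {hs} e w z => [|n IHn] h e w z wz.
  by exists e, (idm e), z; rewrite push_idm; split=> // -[].
have [e1 [u1 [z1 [uz1 P1]]]] := IHn (h \o lift ord0) e w z wz.
have [|e2 [u2 [z2 [uz2 P2]]]] := Pd (h ord0) e1 (w \c u1) z1.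
  by rewrite push_comp uz1.
exists e2, (u1 \c u2), z2; rewrite push_comp uz2; split=> // k.
rewrite compA; case: (unliftP ord0 k) => [k' ->|-> //].
exact: Ps (P1 k') uz2.
Qed.

Lemma dense_res (Q : presheaf) (q q' : Q d) : tin q b = tin q' b ->
  dense (fun e w _ => res w q = res w q').
Proof.
move=> /(tin_eq A_flat)[k [y [c [yc qq]]]] e w z wz.
have [|m [s [t [z' [sz tz wy]]]]] := @flat_cospan _ _ _ A_flat _ _ _ w y z c.
  by rewrite wz.
by exists m, s, z'; split=> //; rewrite wy !res_comp qq.
Qed.

Lemma stable_res (Q : presheaf) (q q' : Q d) :
  stable (fun e w _ => res w q = res w q').
Proof. by move=> e w z e' u z' e1 _; rewrite !res_comp e1. Qed.

Lemma dense_tin (Q : presheaf) (C : tensor A Q) : tproj C = proj b ->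
  dense (fun e _ z => exists q : Q e, tin q z = C).
Proof.
have [c [q [a ->]]] := tensorP C.
rewrite (tproj_tin A_flat) => ab e w z wz; have [_ span _] := A_flat.
have [|m [s [t [z' [sz ta]]]]] := span _ _ z a.
  by rewrite ab -wz proj_push.
exists m, s, z'; split=> //; exists (res t q).
by rewrite -(tin_push A_flat) ta.
Qed.

Lemma stable_tin (Q : presheaf) (C : tensor A Q) :
  stable (fun e _ z => exists q : Q e, tin q z = C).
Proof.
move=> e w z e' u z' [q qz] uz; exists (res u q).
by rewrite -(tin_push A_flat) uz.
Qed.

End Refinement.

Section LimitPoints.
Variables (J : category) (D : functor J PSh) (c : cone D).
Hypotheses (Jfin : finite_category J) (c_limit : is_limit c).

Let Dp (j : J) : presheaf := D j.
Let Dm (i j : J) (u : hom i j) : nattrans (Dp i) (Dp j) := fmap D u.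
Let lim : presheaf := apex c.
Let lg (j : J) : nattrans lim (Dp j) := leg c j.

(** Limits of presheaves are computed objectwise, by testing on cones with a
    representable apex. *)
Lemma limit_sections (e : L) (r : forall j, Dp j e) :
  (forall i j (u : hom i j), Dm u e (r i) = r j) ->
  exists2 q : lim e, (forall j, lg j e q = r j) &
    forall q' : lim e, (forall j, lg j e q' = r j) -> q' = q.
Proof.
move=> rc; pose yl j : @hom PSh (yo e) (D j) := yomap (r j).
have yln i j (u : hom i j) : fmap D u \c yl i = yl j.
  by apply: etrans (yomap_comp (r i) (Dm u)) _; rewrite rc.
have [m [ml mu]] := c_limit (Cone yln).
exists ((m : nattrans (yo e) lim) e (idm e : yo e e)).
  move=> j.
  have := congr1 (fun t : nattrans (yo e) (Dp j) => t e (idm e : yo e e))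
    (ml j).
  by move=> /= mlj; rewrite [LHS]mlj res_idm.
move=> q' q'l; have -> : m = yomap q'; last by rewrite /= res_idm.
by apply: mu => j; apply: etrans (yomap_comp q' (lg j)) _; rewrite q'l.
Qed.

(** First all [z j] are written as [tin (r j) b] at one point [b], then [b] is
    refined until the sections [r j] are compatible, so that they come from a
    section [q] of the limit. For uniqueness two candidates are written as
    sections over one point, which is refined until their legs agree. *)
Lemma tensor_stalk_limit : stalk_limit (map_cone T c).
Proof.
move=> x z zx zc; have [inh _ _] := A_flat.
have [Jf homf] := Jfin.
have [d0 [b0 bx]] := inh x.
have [|d [w0 [b [wb r_ex]]]] := @dense_all d0 b0 J
    (fun j e _ y => exists q : Dp j e, tin q y = z j) Jf
    (fun j => @stable_tin _ _ _) _ d0 (idm d0) b0 (push_idm b0).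
  by move=> j; apply: dense_tin; rewrite bx; exact: zx.
have {w0 wb bx} bx : proj b = x by rewrite -bx -wb proj_push.
have {r_ex} [r rz] : exists r : forall j, Dp j d, forall j, tin (r j) b = z j.
  by exists (fun j => sval (cid (r_ex j))) => j; exact: svalP (cid (r_ex j)).
have [||e [w [y [wy rc]]]] := @dense_all d b J
    (fun i e w _ => forall j (u : hom i j), res w (Dm u d (r i)) = res w (r j))
    Jf _ _ d (idm d) b (push_idm b).
- by move=> i; do 2 (apply: stable_all => ?); exact: stable_res.
- move=> i; apply: dense_all => // j.
    by apply: stable_all => u; exact: stable_res.
  apply: dense_all => // u; first by exact: stable_res.
  apply: dense_res; rewrite rz -(zc i j u) -rz.
  exact/esym/(tmap_tin A_flat (Dm u)).
pose r' j : Dp j e := res (idm d \c w) (r j).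
have r'z j : tin (r' j) y = z j by rewrite -rz /r' -(tin_push A_flat) comp1m wy.
have [|q ql _] := @limit_sections e r'.
  by move=> i j u; rewrite res_nat rc.
exists (tin q y); split.
  split=> [|j]; first by rewrite -bx -wy proj_push; exact: tproj_tin.
  by rewrite -r'z -ql; exact: (tmap_tin A_flat (lg j)).
move=> C [Cx Cl].
have [|k [v [y' [vy [p pC]]]]] :=
    @dense_tin e y lim C _ e (idm e) y (push_idm y).
  by rewrite -wy proj_push in bx; rewrite bx -Cx.
have qy : tin (res v q) y' = tin q y by rewrite -(tin_push A_flat) vy.
have [||m [t [y'' [ty pq]]]] := @dense_all k y' J
    (fun j e w _ => res w (lg j k (res v q)) = res w (lg j k p))
    Jf _ _ k (idm k) y' (push_idm y').
- by move=> j; exact: stable_res.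
- move=> j; apply: dense_res.
  have e1 := tmap_tin A_flat (lg j) (res v q) y'.
  have e2 := tmap_tin A_flat (lg j) p y'.
  rewrite -e1 -e2 qy pC.
  apply: etrans (esym (Cl j)).
  by rewrite -r'z -ql; exact: (tmap_tin A_flat (lg j)).
rewrite comp1m in pq.
rewrite -qy -pC -ty !(tin_push A_flat).
have [|q0 _ q0u] := @limit_sections m (fun j => lg j m (res t p)).
  move=> i j u.
  exact: (congr1 (fun h : nattrans lim (Dp j) => h m (res t p)) (leg_nat c u)).
rewrite (q0u (res t p)) // (q0u (res t (res v q))) // => j.
by rewrite [LHS](res_nat (lg j) t) pq -(res_nat (lg j) t).
Qed.

End LimitPoints.

Lemma tensor_lex : preserves_finite_limits T.
Proof.
move=> J Jfin D c cl; apply: limit_of_stalk_limit => //.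
exact: tensor_stalk_limit.
Qed.

Definition tensor_morphism : geometric_morphism (Sh X) PSh :=
  GeometricMorphism (tensor_adjunction A_flat) tensor_lex.

End TensorLex.

(** * The flat functor of a bundle *)

Section FlatOfBundle.
Variables (S : invSemigroupType) (X : topologicalType) (E : univ_bundle S X).
Local Notation L := (loganathan S).
Local Notation PSh := (classifying_topos S).
Local Notation P := (univ_psh S).
Local Notation mu := (act E).
Local Open Scope group_scope.

Lemma ob_idem (c : L) : idem (sval c). Proof. exact: svalP c. Qed.

Lemma pdom_obP (c : L) (e : E) : pdom (mu (sval c)) e <-> mu (sval c) e e.
Proof. by rewrite -{2}(dom_of_idem (ob_idem c)); exact: sset_domP. Qed.

Definition dom_etale (c : L) : Sh X := open_etale (act_open E (sval c)).

Lemma dom_etaleP (c : L) (e : open_part (pdom (mu (sval c)))) :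
  mu (sval c) (sval e) (sval e).
Proof. by apply/pdom_obP; exact: (svalP e). Qed.

Lemma pdom_elt (s : S) (c : L) (e : open_part (pdom (mu (sval c)))) :
  dom s = sval c -> pdom (mu s) (sval e).
Proof. by move=> sc; apply/sset_domP; rewrite sc; exact: dom_etaleP. Qed.

Lemma papply_elt (s : S) (c : L) (e : open_part (pdom (mu (sval c)))) :
  dom s = sval c -> mu s (sval e) (papply (mu s) (sval e)).
Proof. by move=> sc; apply: papplyP; exact: pdom_elt sc. Qed.

Lemma papply_over (s : S) (c : L) : dom s = sval c ->
  over (fun e : dom_etale c : etale_space X => papply (mu s) (sval e)).
Proof.
move=> sc; split=> e; last exact: act_fibre (papply_elt e sc).
apply: (@continuous_comp _ _ _ (sval : open_part (pdom (mu (sval c))) -> E)).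
  exact: sval_continuous.
apply: (act_continuousP (act_open E)).1; first exact: act_continuous.
exact: pdom_elt.
Qed.

Lemma arrow_range (c d : L) (u : hom d c) (e : dom_etale d : etale_space X) :
  pdom (mu (sval c)) (papply (mu (sval u)) (sval e)).
Proof.
have ue := papply_elt e (svalP u).1.
have cu : sval c * sval u = sval u.
  by apply/nle_ranP; [exact: ob_idem | exact: (svalP u).2].
have /sset_mulP[w uw cw] :
    mu (sval c * sval u) (sval e) (papply (mu (sval u)) (sval e)).
  by rewrite cu.
by exists (papply (mu (sval u)) (sval e)); rewrite {1}(papplyE uw).
Qed.

Definition dom_map (c d : L) (u : hom d c) : hom (dom_etale d) (dom_etale c) :=
  exist _ _ (over_corestrict (act_open E (sval c)) (arrow_range u)
    (papply_over (svalP u).1)).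

Lemma dom_mapP (c d : L) (u : hom d c) (e : dom_etale d : etale_space X)
    (e' : dom_etale c : etale_space X) :
  mu (sval u) (sval e) (sval e') -> app (dom_map u) e = e'.
Proof. by move=> uee; apply: sig_ext; exact: papplyE. Qed.

Lemma dom_map_graph (c d : L) (u : hom d c) (e : dom_etale d : etale_space X) :
  mu (sval u) (sval e) (sval (app (dom_map u) e)).
Proof. exact: papply_elt (svalP u).1. Qed.

Definition dom_functor : functor L (Sh X).
Proof.
refine (@Functor L (Sh X) dom_etale (fun d c u => dom_map u) _ _).
- by move=> c; apply: app_ext => e; apply: dom_mapP; exact: dom_etaleP.
- move=> d' d c u v; apply: app_ext => e; apply: dom_mapP; apply/sset_mulP.
  exists (sval (app (dom_map v) e)); exact: dom_map_graph.
Defined.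

(** The idempotent [dom s] as an arrow, for [dom s <= c]. *)
Definition restr_ob (s : S) (c : L) (sc : s * sval c = s) : @hom L (dom_ob s) c.
Proof.
exists (dom s); split; first exact: dom_of_idem (dom_idem s).
rewrite ran_of_idem; last exact: dom_idem.
exists (dom s); first exact: dom_idem.
by rewrite (idemC (ob_idem c) (dom_idem s)) /dom -mulgA sc.
Defined.

(** If [s] carries [a] to [b], then so does its restriction [r] to [c] and [d],
    and the span consists of [dom r] and [r]. If [u] and [v] agree at [a], then
    [sinv v * u] fixes [a], hence is above an idempotent [e] defined at [a];
    then [r = v * e] is below [u] and [v], which therefore agree on [dom r]. *)
Lemma dom_functor_flat : flat dom_functor.
Proof.
split.
- move=> x; have [e ex [s /sset_domP sy]] := act_inhabited E x.
  have es : pdom (mu (sval (dom_ob s))) e by exists e.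
  by exists (dom_ob s), (exist _ e es).
- move=> c d a b ab.
  have [_ trans _] := (universal_ssetP _).1 (act_universal E (proj (sval b))).
  have [s sab] := trans (exist _ (sval a) ab) (exist _ (sval b) erefl).
  pose r := sval d * s * sval c.
  have rab : mu r (sval a) (sval b).
    apply/sset_mulP; exists (sval a); first exact: dom_etaleP.
    by apply/sset_mulP; exists (sval b) => //; exact: dom_etaleP.
  have rc : r * sval c = r by rewrite /r -mulgA (ob_idem c).
  have rd : nle (ran r) (sval d).
    by apply/nle_ranP; [exact: ob_idem | rewrite /r !mulgA (ob_idem d)].
  have ra : mu (dom r) (sval a) (sval a) by apply/sset_domP; exists (sval b).
  pose v : @hom L (dom_ob r) d := exist _ r (conj erefl rd).
  have ra' : pdom (mu (sval (dom_ob r))) (sval a) by exists (sval a).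
  exists (dom_ob r), (restr_ob rc), v, (exist _ (sval a) ra').
  by split; exact: dom_mapP.
- move=> c d u v a uva.
  have ua := dom_map_graph u a; have va := dom_map_graph v a.
  have wE : sval (app (dom_map u) a) = sval (app (dom_map v) a) by congr sval.
  rewrite wE in ua.
  have [_ _ stab] := (universal_ssetP _).1 (act_universal E (proj (sval a))).
  pose y : {e : E | stalk (proj (sval a)) e} := exist _ (sval a) erefl.
  have [|e [ee es ea]] := stab (sinv (sval v) * sval u) y.
    change (mu (sinv (sval v) * sval u) (sval a) (sval a)); apply/sset_mulP.
    by eexists; [exact: ua | exact/sset_invP].
  have vea : mu (sval v * e) (sval a) (sval (app (dom_map v) a)).
    by apply/sset_mulP; exists (sval a).
  have vev : nle (sval v * e) (sval v) by exact: nle_idemr.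
  have veu : nle (sval v * e) (sval u).
    apply: (@nle_trans _ _ (sval v * (sinv (sval v) * sval u))).
      by apply: nleM => //; exact: nle_refl.
    by rewrite mulgA; apply: nle_idemM; exact: ran_idem.
  set r := sval v * e in vea vev veu.
  have rd : r * sval d = r.
    have vd : sval v * sval d = sval v.
      by rewrite -[RHS]mul_dom (svalP v).1.
    by rewrite /r -mulgA (idemC ee (ob_idem d)) mulgA vd.
  have ra : mu (dom r) (sval a) (sval a).
    by apply/sset_domP; eexists; exact: vea.
  have ra' : pdom (mu (sval (dom_ob r))) (sval a) by exists (sval a).
  exists (dom_ob r), (restr_ob rd), (exist _ (sval a) ra'); split.
    exact: dom_mapP.
  by apply: sig_ext; rewrite /= !nle_mul_dom.
Qed.

Local Notation A := dom_functor.
Local Notation f := (tensor_morphism dom_functor_flat).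

Let recover_fun (t : triple A P) : E :=
  papply (mu (sval (tsec t))) (sval (tpt t)).

Let recover_graph (c : L) (p : P c) (a : shf A c) :
  mu (sval p) (sval a) (recover_fun (Triple p a)).
Proof. exact: papply_elt (svalP p). Qed.

Let recover_fun_eq (t t' : triple A P) :
  triple_eq t t' -> recover_fun t = recover_fun t'.
Proof.
case: t t' => c p a [c' p' a'] [d [u [v [z /= [uz vz uv]]]]].
have zp : mu (sval (res u p)) (sval z) (recover_fun (Triple p a)).
  apply/sset_mulP; exists (sval a); last exact: recover_graph.
  by rewrite -uz; exact: dom_map_graph.
have zp' : mu (sval (res v p')) (sval z) (recover_fun (Triple p' a')).
  apply/sset_mulP; exists (sval a'); last exact: recover_graph.
  by rewrite -vz; exact: dom_map_graph.
rewrite (uv : res u p = res v p') in zp; exact: graph_fun zp zp'.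
Qed.

Definition recover : tensor_etale dom_functor_flat P -> E := tlift recover_fun.

Lemma recover_tin (c : L) (p : P c) (a : shf A c) :
  mu (sval p) (sval a) (recover (tin p a)).
Proof. by rewrite /recover /tin (tliftE dom_functor_flat _ recover_fun_eq). Qed.

Lemma recover_over : over recover.
Proof.
apply: tlift_over; first exact: recover_fun_eq.
by move=> c p; exact: (papply_over (svalP p)).
Qed.

(** A normal form: the class of [(p, a)] depends only on the point [e] to which
    [p] carries [a]. Both sides are restricted to the domain of [k * p]. *)
Lemma tin_univ_id (c k : L) (p : P c) (a : shf A c) (e : shf A k) :
  mu (sval p) (sval a) (sval e) -> tin p a = tin (univ_id k) e.
Proof.
move=> pae; pose r := sval k * sval p.
have rae : mu r (sval a) (sval e).
  by apply/sset_mulP; exists (sval e) => //; exact: dom_etaleP.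
have pc : sval p * sval c = sval p by rewrite -[RHS]mul_dom (svalP p).
have rc : r * sval c = r by rewrite /r -mulgA pc.
have rk : nle (ran r) (sval k).
  by apply/nle_ranP; [exact: ob_idem | rewrite /r !mulgA (ob_idem k)].
have ra : mu (dom r) (sval a) (sval a) by apply/sset_domP; exists (sval e).
have ra' : pdom (mu (sval (dom_ob r))) (sval a) by exists (sval a).
pose a' : shf A (dom_ob r) := exist _ (sval a) ra'.
pose u : @hom L (dom_ob r) c := restr_ob rc.
pose v : @hom L (dom_ob r) k := exist _ r (conj erefl rk).
have <- : push u a' = a by exact: dom_mapP.
have <- : push v a' = e by exact: dom_mapP.
rewrite !(tin_push dom_functor_flat); congr (tin _ _); apply: sig_ext.
rewrite !sval_res /= (nle_mul_dom (nle_idemM _ (ob_idem k))).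
by rewrite /r mulgA (ob_idem k).
Qed.

Lemma support (e : E) : exists (k : L) (e' : shf A k), sval e' = e.
Proof.
have [s /sset_domP se] := sset_effective mu e.
have es : pdom (mu (sval (dom_ob s))) e by exists e.
by exists (dom_ob s), (exist _ e es).
Qed.

Lemma recover_inj : injective recover.
Proof.
move=> C C'; have [c [p [a ->]]] := tensorP C.
have [c' [p' [a' ->]]] := tensorP C'.
move=> pp'; have [k [e ee]] := support (recover (tin p a)).
rewrite (@tin_univ_id _ k _ _ e); last by rewrite ee; exact: recover_tin.
rewrite (@tin_univ_id _ k p' a' e)//; by rewrite ee pp'; exact: recover_tin.
Qed.

Lemma recover_univ_id (k : L) (e : shf A k) :
  recover (tin (univ_id k) e) = sval e.
Proof. exact: graph_fun (recover_tin (univ_id k) e) (dom_etaleP e). Qed.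

Lemma ev_tin (c d : L) (Q : functor (op_cat L) Sets) (q : Q c) (u : yo c d)
    (a : shf A d) :
  @ev S X (inverse_image f) c Q q (tin u a) = tin (res u q) a.
Proof. exact: (tmap_tin dom_functor_flat (yomap q)). Qed.

Lemma recover_equivariant : @equivariant S X (bundle_of f) E recover.
Proof.
move=> s _ _ [b [<- <-]].
have [d [u [a ->]]] := tensorP (b : tensor A (yo (dom_ob s))).
rewrite !ev_tin.
have := recover_tin (res u (univ_elt s)) a.
rewrite sval_res => /sset_mulP[v uv sv].
have du : sval (univ_dom s) * sval u = sval u := mul_univ_id u.
have uv' := recover_tin (res u (univ_dom s)) a; rewrite sval_res du in uv'.
by rewrite (graph_fun uv' uv).
Qed.

Lemma recover_section : {g : E -> tensor_etale dom_functor_flat P |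
  cancel recover g & cancel g recover}.
Proof.
have surj e : exists C, recover C = e.
  have [k [e' <-]] := support e; exists (tin (univ_id k) e').
  exact: recover_univ_id.
by apply/cid2; have [g gK] := choice surj; exists g => // C; exact: recover_inj.
Qed.

Lemma recover_inverse_equivariant g : cancel recover g -> cancel g recover ->
  @equivariant S X E (bundle_of f) g.
Proof.
move=> gK Kg s e e' see.
have es : pdom (mu (sval (dom_ob s))) e by exists e; apply/sset_domP; exists e'.
pose ek : shf A (dom_ob s) := exist _ e es.
exists (tin (idm (dom_ob s) : yo (dom_ob s) (dom_ob s)) ek).
rewrite !ev_tin !res_idm.
split; apply: recover_inj; rewrite Kg.
  exact: graph_fun (recover_tin (univ_dom s) ek) (dom_etaleP ek).
exact: graph_fun (recover_tin (univ_elt s) ek) see.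
Qed.

Lemma bundle_of_surjective : exists (k : geometric_morphism (Sh X) PSh)
    (u : univ_hom (bundle_of k) E) (v : univ_hom E (bundle_of k)),
  cancel (sval u) (sval v) /\ cancel (sval v) (sval u).
Proof.
have [g gK Kg] := recover_section.
exists f, (exist _ recover (conj recover_over recover_equivariant)).
by exists (exist _ g (conj (over_inverse recover_over gK Kg)
  (recover_inverse_equivariant gK Kg))).
Qed.

End FlatOfBundle.

(** * Equivalences of categories *)

Section Equivalence.
Variables (C D : category) (F : functor C D).
Hypothesis F_full : forall a b (h : hom (F a) (F b)),
  exists t : hom a b, fmap F t = h.
Hypothesis F_faithful : forall a b (t t' : hom a b),
  fmap F t = fmap F t' -> t = t'.
Hypothesis F_surj : forall d,
  exists (a : C) (u : hom (F a) d) (v : hom d (F a)),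
    v \c u = idm (F a) /\ u \c v = idm d.

Let inv_ob (d : D) : C := sval (cid (F_surj d)).
Let to_D (d : D) : hom (F (inv_ob d)) d := sval (cid (svalP (cid (F_surj d)))).
Let of_D (d : D) : hom d (F (inv_ob d)) :=
  sval (cid (svalP (cid (svalP (cid (F_surj d)))))).
Let of_toK (d : D) : of_D d \c to_D d = idm _.
Proof. exact: (svalP (cid (svalP (cid (svalP (cid (F_surj d))))))).1. Qed.
Let to_ofK (d : D) : to_D d \c of_D d = idm d.
Proof. exact: (svalP (cid (svalP (cid (svalP (cid (F_surj d))))))).2. Qed.

Let full_arrow a b (h : hom (F a) (F b)) : hom a b := sval (cid (F_full h)).
Let full_arrowK a b (h : hom (F a) (F b)) : fmap F (full_arrow h) = h.
Proof. exact: svalP (cid (F_full h)). Qed.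

Definition inverse_functor : functor D C.
Proof.
refine (@Functor D C inv_ob
  (fun d d' h => full_arrow (of_D d' \c h \c to_D d)) _ _).
- by move=> d; apply: F_faithful; rewrite full_arrowK fmap1 compm1 of_toK.
- move=> d d' d'' h' h; apply: F_faithful; rewrite fmapM !full_arrowK.
  by rewrite !compA -(compA _ (to_D d') (of_D d')) to_ofK compm1.
Defined.

Lemma fully_faithful_equivalence : cat_equivalent C D.
Proof.
exists F, inverse_functor; split.
- have n1 a b (t : hom a b) :
      full_arrow (to_D (F b)) \c fmap (inverse_functor \of F) t =
      fmap (id_functor C) t \c full_arrow (to_D (F a)).
    by apply: F_faithful; rewrite /= !fmapM !full_arrowK !compA to_ofK comp1m.
  have n2 a b (t : hom a b) :
      full_arrow (of_D (F b)) \c fmap (id_functor C) t =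
      fmap (inverse_functor \of F) t \c full_arrow (of_D (F a)).
    by apply: F_faithful; rewrite /= !fmapM !full_arrowK -!compA to_ofK compm1.
  exists (@NatTrans C C (inverse_functor \of F) (id_functor C) _ n1),
    (@NatTrans C C (id_functor C) (inverse_functor \of F) _ n2) => a.
  by split; apply: F_faithful; rewrite /= fmapM !full_arrowK fmap1.
- have n1 a b (t : hom a b) : to_D b \c fmap (F \of inverse_functor) t =
      fmap (id_functor D) t \c to_D a.
    by rewrite /= full_arrowK !compA to_ofK comp1m.
  have n2 a b (t : hom a b) : of_D b \c fmap (id_functor D) t =
      fmap (F \of inverse_functor) t \c of_D a.
    by rewrite /= full_arrowK -!compA to_ofK compm1.
  exists (@NatTrans D D (F \of inverse_functor) (id_functor D) to_D n1),
    (@NatTrans D D (id_functor D) (F \of inverse_functor) of_D n2) => d.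
  by split; rewrite /= ?of_toK ?to_ofK.
Qed.

End Equivalence.

Theorem corollary18 (S : invSemigroupType) (X : topologicalType) :
  cat_equivalent (Geom (Sh X) (classifying_topos S)) (Univ S X).
Proof.
apply: (fully_faithful_equivalence (F := bundle_functor S X)).
- by move=> f g h; exact: bundle_map_full.
- by move=> f g t t'; exact: bundle_map_faithful.
- move=> E; have [f [u [v [uK vK]]]] := bundle_of_surjective E.
  exists f, u, v; split; apply: sig_ext; apply/funext => e; first exact: uK.
  exact: vK.
Qed.
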